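(* Let $k$ be an algebraically closed field of characteristic $p\ge 0$ and let $n\ge 2$. Let $\mathcal F$ be a codimension one foliation on $\mathbb P^n_k$ of degree $d$ and assume that $\mathrm{Sing}(\mathcal F)$ has codimension at least $3$. Then $p>0$, $d+2$ is a multiple of $p$ and $\mathcal F$ is given by the kernel of a closed projective $1$-form $\Omega$ on $\mathbb A^{n+1}_k$. Moreover, the following conditions are equivalent: (1) $\mathcal F$ admits a reduced invariant hypersurface; (2) $\Omega$ is exact, i.e. there exists a homogeneous polynomial $G$ of degree $d+2$ such that $\Omega=dG$.
   Context: A codimension one foliation $\mathcal F$ of degree $d$ on $\mathbb P^n_k$ is given by a nonzero $\Omega\in H^0(\mathbb P^n_k,\Omega^1_{\mathbb P^n_k}(d+2))$, unique up to a scalar, whose zero locus $\mathrm{Sing}(\mathcal F)$ has codimension $\ge 2$, and which is integrable: $\Omega\wedge d\Omega=0$. In homogeneous coordinates, $\Omega=\sum_{i=0}^n A_i\,dx_i$ with $A_i\in k[x_0,\dots,x_n]$ homogeneous of degree $d+1$ and $i_R\Omega=0$, where $R=\sum_i x_i\partial_{x_i}$ is the radial vector field; such an $\Omega$ is called a projective $1$-form on $\mathbb A^{n+1}_k$ defining $\mathcal F$. A reduced hypersurface $Y$ is invariant by $\mathcal F$ if $\omega\wedge\frac{df}{f}$ is a regular $2$-form for any local equation $f$ of $Y$ and any local $1$-form $\omega$ (with zero locus of codimension $\ge2$) defining $\mathcal F$. The empty set is regarded as having codimension larger than any integer. *)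

(* Defs.v *)
From mathcomp Require Import all_boot all_order all_algebra.
From mathcomp Require Import ring.
From mathcomp Require Import mpoly.

Set Implicit Arguments.
Unset Strict Implicit.
Unset Printing Implicit Defensive.

Import GRing.Theory.
Local Open Scope ring_scope.
Local Open Scope quotient_scope.

Definition has_characteristic (R : nzRingType) (p : nat) : Prop :=
  if p == 0%N then [pchar R] =i pred0 else p \in [pchar R].

Section ProjectiveSpace.

Variables (k : closedFieldType) (n : nat).

(* A point of P^n is handled through its representatives, the nonzero vectors
   of k^(n+1).  A subset of P^n is the corresponding subset of k^(n+1) \ {0};
   the sets considered below are cut out by homogeneous equations, hence they
   are unions of classes. *)
Definition vec := 'I_n.+1 -> k.

Definition proj_space (v : vec) : Prop := exists i, v i != 0.

Definition proj_closed (Z : vec -> Prop) : Prop :=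
  exists S : {mpoly k[n.+1]} -> Prop,
    (forall g, S g -> exists e, g \is e.-homog) /\
    (forall v, Z v <-> proj_space v /\ (forall g, S g -> g.@[v] = 0)).

Definition proj_open (U : vec -> Prop) : Prop :=
  exists2 Z, proj_closed Z & forall v, U v <-> proj_space v /\ ~ Z v.

Definition subset (A B : vec -> Prop) : Prop := forall v, A v -> B v.

Definition closed_in (U W : vec -> Prop) : Prop :=
  exists2 Z, proj_closed Z & forall v, W v <-> U v /\ Z v.

Definition irreducible_closed_in (U W : vec -> Prop) : Prop :=
  [/\ closed_in U W,
      exists v, W v
    & forall Z1 Z2, closed_in U Z1 -> closed_in U Z2 ->
        subset W (fun v => Z1 v \/ Z2 v) -> subset W Z1 \/ subset W Z2].

(* "Z has codimension at least c in U": the codimension of an irreducible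
   closed W is the supremum of the lengths of chains of irreducible closed
   subsets of U starting at W; that of Z is the infimum over all such W
   contained in Z.  For empty Z the condition holds for every c. *)
Definition codim_ge (U Z : vec -> Prop) (c : nat) : Prop :=
  forall W, irreducible_closed_in U W -> subset W Z ->
  exists chain : nat -> vec -> Prop,
    [/\ forall v, chain 0%N v <-> W v,
        forall i, (i <= c)%N -> irreducible_closed_in U (chain i)
      & forall i, (i < c)%N ->
          subset (chain i) (chain i.+1) /\ ~ subset (chain i.+1) (chain i)].

(* Polynomial 1-forms: A stands for \sum_i A i dx_i. *)
Definition polyform := 'I_n.+1 -> {mpoly k[n.+1]}.

(* The coefficient of dx_i /\ dx_j in dA. *)
Definition ext_d (A : polyform) (i j : 'I_n.+1) : {mpoly k[n.+1]} :=
  (A j)^`M(i) - (A i)^`M(j).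

Definition closed_form (A : polyform) : Prop := forall i j, ext_d A i j = 0.

(* The coefficients of dx_i /\ dx_j /\ dx_l in A /\ dA vanish. *)
Definition integrable (A : polyform) : Prop :=
  forall i j l,
    A i * ext_d A j l + A j * ext_d A l i + A l * ext_d A i j = 0.

(* The element of H^0(P^n, Omega^1(d+2)) given by A: homogeneity, and
   vanishing contraction with the radial vector field. *)
Definition projective_form (d : nat) (A : polyform) : Prop :=
  (forall i, A i \is d.+1.-homog) /\ \sum_(i < n.+1) 'X_i * A i = 0.

Definition sing_form (A : polyform) (v : vec) : Prop :=
  proj_space v /\ forall i, (A i).@[v] = 0.

(* The form is only determined by the foliation up to a nonzero scalar,
   see [defines]. *)
Record foliation (d : nat) := Foliation {
  fol_form : polyform;
  fol_proj : projective_form d fol_form;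
  fol_neq0 : exists i, fol_form i != 0;
  fol_integrable : integrable fol_form;
  fol_codim : codim_ge proj_space (sing_form fol_form) 2
}.

Definition Sing d (F : foliation d) : vec -> Prop := sing_form (fol_form F).

Definition defines d (F : foliation d) (A : polyform) : Prop :=
  exists2 c : k, c != 0 & forall i, A i = c *: fol_form F i.

(* Rational objects: those on P^n are written in homogeneous coordinates, as
   elements of the fraction field of k[x_0, ..., x_n]. *)
Definition ratfun := {fraction {mpoly k[n.+1]}}.

Definition frac_of (a : {mpoly k[n.+1]}) : ratfun := FracField.tofrac a.

(* The derivation of the fraction field extending d/dx_i: quotient rule on a
   chosen representative, see [fderivE] for an arbitrary one. *)
Definition fderiv (i : 'I_n.+1) (r : ratfun) : ratfun :=
  let a := \n_(repr r) in
  let b := \d_(repr r) in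
  frac_of (a^`M(i) * b - a * b^`M(i)) / frac_of b ^+ 2.

Lemma frac_numden (r : ratfun) :
  r = frac_of \n_(repr r) / frac_of \d_(repr r).
Proof.
rewrite -[LHS]reprK; move: (repr r) => x.
have d0 := denom_ratioP x.
have D0 : frac_of \d_x != 0 by rewrite /frac_of tofrac_eq0.
apply/(mulIf D0); rewrite mulfVK // /frac_of.
unlock FracField.tofrac; rewrite -[LHS]FracField.pi_mul.
apply/eqP; rewrite FracField.equivf_def /FracField.mulf.
by rewrite !numden_Ratio ?mulr1 ?oner_neq0 // mulrC.
Qed.

Lemma fderivE (i : 'I_n.+1) (a b : {mpoly k[n.+1]}) : b != 0 ->
  fderiv i (frac_of a / frac_of b) =
  frac_of (a^`M(i) * b - a * b^`M(i)) / frac_of b ^+ 2.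
Proof.
have f0 c : c != 0 -> frac_of c != 0 by rewrite /frac_of tofrac_eq0.
move=> b0; rewrite /fderiv; set r := frac_of a / frac_of b.
have b10 := denom_ratioP (repr r); have := frac_numden r.
move: (\n_(repr r)) (\d_(repr r)) b10 => a1 b1 b10 Er.
have E : a * b1 = a1 * b.
  apply/eqP; rewrite -tofrac_eq !tofracM; apply/eqP.
  move/eqP: Er; rewrite /r eqr_div ?f0 // => /eqP.
  by rewrite /frac_of.
have dE : a^`M(i) * b1 + a * b1^`M(i) = a1^`M(i) * b + a1 * b^`M(i).
  by rewrite -!mderivM E.
apply/eqP; rewrite eqr_div ?expf_neq0 ?f0 //.
rewrite /frac_of -!tofracXn -!tofracM tofrac_eq; apply/eqP.
have dE1 : a1^`M(i) * b = a^`M(i) * b1 + a * b1^`M(i) - a1 * b^`M(i).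
  by rewrite dE addrK.
have -> : (a1^`M(i) * b1 - a1 * b1^`M(i)) * b ^+ 2 =
  (a1^`M(i) * b) * b1 * b - (a1 * b) * b * b1^`M(i) by ring.
have -> : (a^`M(i) * b - a * b^`M(i)) * b1 ^+ 2 =
  a^`M(i) * b * b1 ^+ 2 - (a * b1) * b^`M(i) * b1 by ring.
rewrite dE1 -E; have -> : (a^`M(i) * b1 + a * b1^`M(i) - a1 * b^`M(i)) * b1 * b
  = a^`M(i) * b * b1 ^+ 2 + (a * b1) * b * b1^`M(i) - (a1 * b) * b^`M(i) * b1.
  by ring.
by rewrite -E; ring.
Qed.

(* r is a section over U of O(e). *)
Definition regular_section (U : vec -> Prop) (e : int) (r : ratfun) : Prop :=
  forall v, U v -> exists s t a b,
    [/\ a \is s.-homog, b \is t.-homog, s%:Z = t%:Z + e,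
        b.@[v] != 0 & r = frac_of a / frac_of b].

Definition vanishes_at (r : ratfun) (v : vec) : Prop :=
  exists a b, [/\ b.@[v] != 0, a.@[v] = 0 & r = frac_of a / frac_of b].

(* Regular 1-forms and 2-forms on U, through the Euler sequence: sections of
   Omega^q are the forms in the dx_i with coefficients in O(-q) that are
   killed by contraction with the radial vector field.  A 2-form is given by
   the alternating family of the coefficients of dx_i /\ dx_j. *)
Definition ratform := 'I_n.+1 -> ratfun.

Definition regular_1form (U : vec -> Prop) (w : ratform) : Prop :=
  (forall i, regular_section U (-1) (w i)) /\
  \sum_(i < n.+1) frac_of 'X_i * w i = 0.

Definition regular_2form (U : vec -> Prop) (eta : 'I_n.+1 -> ratform) : Prop :=
  [/\ forall i j, regular_section U (- 2%:Z) (eta i j),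
      forall i, eta i i = 0,
      forall i j, eta i j = - eta j i
    & forall j, \sum_(i < n.+1) frac_of 'X_i * eta i j = 0].

Definition wedge_dlog (w : ratform) (f : ratfun) (i j : 'I_n.+1) : ratfun :=
  (w i * fderiv j f - w j * fderiv i f) / f.

(* A reduced hypersurface of degree e, given by a homogeneous equation. *)
Definition reduced_hypersurface (e : nat) (Y : {mpoly k[n.+1]}) : Prop :=
  [/\ (0 < e)%N, Y != 0, Y \is e.-homog
    & forall g h, Y = g ^+ 2 * h -> exists c : k, g = c%:MP].

(* f is a regular function generating the ideal sheaf of {Y = 0} on U: it is
   u * Y for a nowhere vanishing section u of O(-e) over U. *)
Definition local_equation (e : nat) (Y : {mpoly k[n.+1]})
    (U : vec -> Prop) (f : ratfun) : Prop :=
  exists u : ratfun,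
    [/\ u != 0, regular_section U (- e%:Z) u, regular_section U e%:Z u^-1
      & f = u * frac_of Y].

Definition local_defining_form d (F : foliation d)
    (U : vec -> Prop) (w : ratform) : Prop :=
  [/\ regular_1form U w,
      exists2 h : ratfun, h != 0 & forall i, w i = h * frac_of (fol_form F i)
    & codim_ge U (fun v => U v /\ forall i, vanishes_at (w i) v) 2].

Definition invariant_hypersurface d (F : foliation d)
    (e : nat) (Y : {mpoly k[n.+1]}) : Prop :=
  forall (U : vec -> Prop) (f : ratfun) (w : ratform),
    proj_open U -> (exists v, U v) ->
    local_equation e Y U f -> local_defining_form F U w ->
    regular_2form U (wedge_dlog w f).

Definition has_reduced_invariant_hypersurface d (F : foliation d) : Prop :=
  exists e Y, reduced_hypersurface e Y /\ invariant_hypersurface F e Y.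

Definition exact_form (d : nat) (A : polyform) : Prop :=
  exists2 G : {mpoly k[n.+1]}, G \is d.+2.-homog & forall i, A i = G^`M(i).

End ProjectiveSpace.

(* Main.v *)
From HB Require Import structures.
From Pilot Require Import Defs.
From mathcomp Require Import all_boot all_order all_algebra.
From mathcomp Require Import ring zify.
From mathcomp Require Import mpoly.
From Stdlib Require Import Classical_Prop ClassicalEpsilon.

(* The ideal (A_0, ..., A_n) of the coefficients of Omega has depth at least 3,
   so that the Koszul complex of (A_0, ..., A_n) is exact in degrees 1 and 2.
   Integrability gives Omega /\ dOmega = 0, hence dOmega = Omega /\ alpha, and
   comparing degrees dOmega = 0; contracting with the radial field then yields
   (d + 2) Omega = 0.

   If Y is an invariant hypersurface, then Omega /\ dY = Y Theta and again
   Theta = Omega /\ alpha, so that Omega /\ dY = 0 by comparing degrees, and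
   dY = h Omega by exactness in degree 1.  As Omega is closed, h has the same
   property as Y unless dh = 0; descending on the degree, dP = h Omega with h a
   nonzero constant of the derivations.  Splitting P along the monomials in the
   p-th powers of the variables, P = P_0 + h G with dP_0 = 0, and Omega = dG.
   Conversely, if Omega = dG then {G = 0} is invariant, and it is reduced since a
   square factor of G divides all the A_i.

   In coordinates where some A_i is monic in the
   last variable, elimination produces a nonzero r_2 in the ideal not involving
   that variable, and, once r_2 is made monic in another variable, an r_1
   involving neither: (r_1, r_2, A_i) is a regular sequence.  Elimination fails
   only if the common zeros dominate an affine space of too large dimension,
   which the chains of irreducible closed sets in the definition of the
   codimension exclude, since each step lowers the transcendence degree. *)

Set Implicit Arguments.
Unset Strict Implicit.
Unset Printing Implicit Defensive.

Import Order.TTheory GRing.Theory.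
Local Open Scope ring_scope.

(** * Elimination and the Koszul complex over a polynomial ring in one variable *)

Section UnitLead.

Variable R : idomainType.
Implicit Types (f g q : {poly R}) (r : R).

Definition unit_lead f := lead_coef f \is a GRing.unit.

Lemma unit_lead_neq0 f : unit_lead f -> f != 0.
Proof. by apply: contraTneq => ->; rewrite /unit_lead lead_coef0 unitr0. Qed.

Lemma unit_lead_edivp f g : unit_lead f ->
  exists q s, g = q * f + s /\ (size s < size f)%N.
Proof.
move=> uf; exists (g %/ f), (g %% f); rewrite ltn_modp unit_lead_neq0 //.
by split=> //; apply: Pdiv.IdomainUnit.divp_eq.
Qed.

Lemma unit_lead_mul_small f g q : f != 0 ->
  f * g = q -> (size q < size f)%N -> g = 0 /\ q = 0.
Proof.
move=> f0 <-; case: (eqVneq g 0) => [->|g0]; first by rewrite mulr0.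
rewrite size_mul //; case: (size g) (size_poly_gt0 g) => [|s _]; first by rewrite g0.
by rewrite addnS /= ltnNge leq_addr.
Qed.

Lemma size_polyCM_le r q : (size (r%:P * q)%R <= size q)%N.
Proof. by rewrite mul_polyC size_scale_leq. Qed.

(** Dividing [b] by [f] with remainder leaves a multiple of [f] equal to a polynomial of smaller
    size, so both vanish. This lemma and the next two supply regularity: of [f] modulo one or two
    constants, and of a nonzero constant modulo [f]. *)
Lemma unit_lead_div_const f r a b : unit_lead f ->
  f * a = r%:P * b -> exists q, a = r%:P * q.
Proof.
move=> uf; have [q [s [-> sz]]] := unit_lead_edivp b uf; move=> e.
exists q; apply/eqP; rewrite -subr_eq0; apply/eqP.
have e' : f * (a - r%:P * q) = r%:P * s by rewrite mulrBr e; ring.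
by case: (unit_lead_mul_small (unit_lead_neq0 uf) e'
  (leq_ltn_trans (size_polyCM_le _ _) sz)).
Qed.

Lemma unit_lead_div_const2 f g r1 r2 a b : unit_lead f ->
  f * g = r1%:P * a + r2%:P * b -> exists s t, g = r1%:P * s + r2%:P * t.
Proof.
move=> uf; have [qa [sa [-> sza]]] := unit_lead_edivp a uf.
have [qb [sb [-> szb]]] := unit_lead_edivp b uf; move=> e.
exists qa, qb; apply/eqP; rewrite -subr_eq0; apply/eqP.
have e' : f * (g - (r1%:P * qa + r2%:P * qb)) = r1%:P * sa + r2%:P * sb.
  by rewrite mulrBr e; ring.
case: (unit_lead_mul_small (unit_lead_neq0 uf) e') => //.
apply: leq_ltn_trans (size_polyD _ _) _; rewrite gtn_max.
by rewrite !(leq_ltn_trans (size_polyCM_le _ _)).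
Qed.

Lemma unit_lead_dvd_const f r b c : unit_lead f -> r != 0 ->
  r%:P * b = f * c -> exists q, b = q * f.
Proof.
move=> uf r0; have [q [s [-> sz]]] := unit_lead_edivp b uf; move=> e.
exists q; have e' : f * (c - r%:P * q) = r%:P * s by rewrite mulrBr -e; ring.
case: (unit_lead_mul_small (unit_lead_neq0 uf) e'
  (leq_ltn_trans (size_polyCM_le _ _) sz)) => _ /eqP.
by rewrite mulf_eq0 polyC_eq0 (negPf r0) /= => /eqP ->; rewrite addr0.
Qed.

Lemma const_dvd_coef r (a : {poly R}) : (forall i, exists c, a`_i = r * c) ->
  exists q, a = r%:P * q.
Proof.
move=> H; pose c i := proj1_sig (constructive_indefinite_description _ (H i)).
exists (\poly_(i < size a) c i); apply/polyP=> i.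
rewrite coefCM coef_poly; case: ltnP => [_|/(nth_default 0) ->]; last by rewrite mulr0.
by rewrite /c; case: constructive_indefinite_description.
Qed.

End UnitLead.

(** * The extension step of elimination theory *)

Section Extension.

Variables (k : closedFieldType) (R : idomainType).
Variables (ev : {rmorphism R -> k}) (lift : {rmorphism k -> R}).
Hypothesis evK : cancel lift ev.
Variable J : {poly R} -> Prop.
Hypothesis JD : forall f g, J f -> J g -> J (f + g).
Hypothesis JM : forall f g : {poly R}, J g -> J (f * g).

Lemma ideal_sum (I : finType) (F : I -> {poly R}) :
  J 0 -> (forall i, J (F i)) -> J (\sum_i F i).
Proof. by move=> J0 JF; elim/big_ind: _ => //; exact: JD. Qed.

(* If the fibre of J over ev is the unit ideal, then the rests of X^q f modulo
   Q form a square matrix which specializes to the identity, so that J contains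
   its determinant by Cramer's rule. *)
Lemma unit_fibre_const Q : J Q -> unit_lead Q ->
  (exists2 f, J f & map_poly ev f = 1) ->
  exists2 r, J r%:P & ev r != 0.
Proof.
move=> JQ uQ [f Jf ef1].
have J0 : J 0 by rewrite -(mul0r Q); exact: JM.
have Q0 := unit_lead_neq0 uQ.
pose e := (size Q).-1; have szQ : size Q = e.+1.
  by rewrite prednK // size_poly_gt0.
have evQ : size (map_poly ev Q) = size Q.
  by rewrite size_map_poly_id0 // -unitfE rmorph_unit.
case e0: e => [|e1].
  have eQ : Q = (lead_coef Q)%:P by rewrite lead_coefE szQ e0; apply: size1_polyC; rewrite szQ e0.
  exists (lead_coef Q); first by rewrite -eQ.
  by rewrite -unitfE rmorph_unit.
have /(_ _)/constructive_indefinite_description rq (q : 'I_e1.+1) :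
   exists s, [/\ J s, (size s <= e1.+1)%N & map_poly ev s = 'X^q].
  have [a [s [E sz]]] := unit_lead_edivp ('X^q * f) uQ.
  rewrite szQ e0 ltnS in sz.
  exists s; split=> //.
    have -> : s = 'X^q * f + (- a) * Q by rewrite E; ring.
    by apply: JD; exact: JM.
  have := congr1 (map_poly ev) E; rewrite rmorphD !rmorphM /= ef1 map_polyXn mulr1 => E'.
  apply/eqP; rewrite -subr_eq0; apply/eqP.
  have E2 : map_poly ev Q * - map_poly ev a = map_poly ev s - 'X^q by rewrite E'; ring.
  case: (unit_lead_mul_small _ E2) => //.
    by rewrite -size_poly_gt0 evQ szQ.
  rewrite evQ szQ e0 ltnS; apply: leq_trans (size_polyD _ _) _.
  rewrite geq_max size_polyN size_polyXn ltn_ord andbT.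
  exact: leq_trans (size_poly _ _) sz.
pose M := \matrix_(q < e1.+1, l < e1.+1) (proj1_sig (rq q))`_l.
have evM : map_mx ev M = 1%:M.
  apply/matrixP=> q l; rewrite !mxE; case: (rq q) => s /= [_ _ E].
  by rewrite -coef_map E coefXn eq_sym.
exists (\det M); last by rewrite -det_map_mx evM det1 oner_neq0.
have rE q : proj1_sig (rq q) = \sum_(l < e1.+1) (M q l)%:P * 'X^l.
  have -> : proj1_sig (rq q) = \poly_(l < e1.+1) (proj1_sig (rq q))`_l.
    apply/polyP=> l; rewrite coef_poly; case: ltnP => // lle.
    by apply: nth_default; apply: leq_trans lle; case: (rq q) => s [].
  by rewrite poly_def; apply: eq_bigr => l _; rewrite mxE mul_polyC.
have -> : (\det M)%:P = \sum_q (\adj M 0 q)%:P * proj1_sig (rq q).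
  under eq_bigr => q _ do rewrite rE mulr_sumr.
  rewrite exchange_big /=.
  have adjE l : \sum_q (\adj M 0 q)%:P * ((M q l)%:P * 'X^l) =
                (\det M *+ (0 == l))%:P * 'X^l.
    have := congr1 (fun N : 'M_e1.+1 => N 0 l) (mul_adj_mx M); rewrite !mxE => <-.
    rewrite rmorph_sum mulr_suml; apply: eq_bigr => q _.
    by rewrite rmorphM mulrA.
  under eq_bigr => l _ do rewrite adjE.
  rewrite big_ord_recl /= expr0 mulr1 mulr1n big1 ?addr0 // => l _.
  by rewrite mulr0n polyC0 mul0r.
by apply: ideal_sum => // q; apply: JM; case: (rq q) => s [].
Qed.


(** The specializations of elements of [J] form an ideal, since [lift] provides preimages of the
    multipliers. An element of least size generates it: either it has a root [w], or it is a nonzero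
    constant, which [unit_fibre_const] excludes. *)
Lemma ideal_extension Q : J Q -> unit_lead Q ->
  (forall r, J r%:P -> ev r = 0) ->
  exists w, forall f, J f -> (map_poly ev f).[w] = 0.
Proof.
move=> JQ uQ Jev.
have Q0 : map_poly ev Q != 0.
  by rewrite map_poly_eq0_id0 ?unit_lead_neq0 // -unitfE rmorph_unit.
pose P s := exists f, [/\ J f, map_poly ev f != 0 & size (map_poly ev f) = s].
have [s [[f [Jf f0 sf]] smin]] : exists s, P s /\ forall t, P t -> (s <= t)%N.
  have : P (size (map_poly ev Q)) by exists Q.
  move: (size _) => s; elim/ltn_ind: s => s IH Ps.
  case: (classic (exists2 t, (t < s)%N & P t)) => [[t ts Pt]|N]; first exact: IH Pt.
  exists s; split=> // t Pt; rewrite leqNgt; apply/negP=> ts.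
  by apply: N; exists t.
have dvd g : J g -> map_poly ev f %| map_poly ev g.
  move=> Jg; apply/negbNE/negP=> nd.
  have := ltn_modp (map_poly ev g) (map_poly ev f); rewrite f0 ltnNge => /negP; apply.
  rewrite sf; apply: smin; pose q := map_poly lift (map_poly ev g %/ map_poly ev f).
  have eq : map_poly ev q = map_poly ev g %/ map_poly ev f.
    by rewrite -map_poly_comp map_poly_id // => x _ /=; rewrite evK.
  have E : map_poly ev (g + (- q) * f) = map_poly ev g %% map_poly ev f.
    rewrite rmorphD rmorphM rmorphN /= eq {1}(divp_eq (map_poly ev g) (map_poly ev f)).
    by rewrite mulNr addrAC subrr add0r.
  exists (g + (- q) * f); rewrite E; split=> //.
  by apply: JD => //; apply: JM.
have [/eqP s1|s1] := eqVneq (size (map_poly ev f)) 1%N; last first.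
  have [w rw] := closed_rootP _ s1.
  by exists w => g /dvd/dvdpP[q ->]; rewrite hornerM (rootP rw) mulr0.
case: (unit_fibre_const JQ uQ) => [|r /Jev ->]; last by rewrite eqxx.
have [c c0 fc] := size_poly1P _ s1.
exists ((lift c^-1)%:P * f); first exact: JM.
by rewrite rmorphM /= fc map_polyC /= evK -polyCM mulVf.
Qed.

End Extension.

(** * Exactness of the Koszul complex in degrees 1 and 2 *)

Section Koszul.

Variables (R : idomainType) (N : nat).
Implicit Types (A al be : 'I_N -> {poly R}) (B : 'I_N -> 'I_N -> {poly R}).

(** Contraction with [c] makes [A i0] divide [r%:P * b i0], and [r] is regular modulo [A i0]. *)
Lemma koszul_exact1 A (i0 : 'I_N) (r : R) (c b : 'I_N -> {poly R}) :
  unit_lead (A i0) -> r != 0 -> r%:P = \sum_l c l * A l ->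
  (forall i j, A i * b j = A j * b i) ->
  exists h, forall j, b j = h * A j.
Proof.
move=> u0 r0 rE Ab.
have E : r%:P * b i0 = A i0 * \sum_l c l * b l.
  rewrite rE mulr_suml mulr_sumr; apply: eq_bigr => l _.
  by rewrite -mulrA Ab; ring.
have [h hE] := unit_lead_dvd_const u0 r0 E.
exists h => j; apply: (mulfI (unit_lead_neq0 u0)).
by rewrite Ab hE; ring.
Qed.

Definition wedge A al i j := A i * al j - A j * al i.

Definition alternating B := (forall i, B i i = 0) /\ (forall i j, B i j = - B j i).

(** The sequence [r1], [r2], [A i0] is regular. Contraction with [c1] and [c2] writes the multiples
    of [B] by [r1] and [r2] as wedges of [A] with [al] and [be]; it remains to change [al] by a
    multiple of [A] so that [r1] divides it. *)
Lemma koszul_exact2 A (i0 : 'I_N) (r1 r2 : R) (c1 c2 : 'I_N -> {poly R}) B :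
  unit_lead (A i0) -> r1 != 0 ->
  r1%:P = \sum_l c1 l * A l -> r2%:P = \sum_l c2 l * A l ->
  (forall x y : R, r2 * x = r1 * y -> exists z, x = r1 * z) ->
  alternating B ->
  (forall i j l, A i * B j l + A j * B l i + A l * B i j = 0) ->
  exists al, forall i j, B i j = wedge A al i j.
Proof.
move=> u0 r10 r1E r2E cop [_ Balt] AB.
have AlB l i j : A l * B i j = A i * B l j - A j * B l i.
  have -> : A l * B i j =
      (A i * B j l + A j * B l i + A l * B i j) - A i * B j l - A j * B l i by ring.
  by rewrite AB (Balt l j); ring.
have contr (r : R) (c : 'I_N -> {poly R}) i j : r%:P = \sum_l c l * A l ->
    r%:P * B i j = wedge A (fun j => \sum_l c l * B l j) i j.
  move=> ->; rewrite /wedge mulr_suml !mulr_sumr -sumrB; apply: eq_bigr => l _.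
  by rewrite -mulrA AlB; ring.
have exact1 := koszul_exact1 u0 r10 r1E.
pose al := fun j => \sum_l c1 l * B l j.
pose be := fun j => \sum_l c2 l * B l j.
have r1B i j : r1%:P * B i j = wedge A al i j := contr _ _ i j r1E.
have r2B i j : r2%:P * B i j = wedge A be i j := contr _ _ i j r2E.
have [h hE] : exists h, forall j, r2%:P * al j - r1%:P * be j = h * A j.
  apply: exact1 => i j.
  have E : r2%:P * wedge A al i j = r1%:P * wedge A be i j by rewrite -r1B -r2B; ring.
  by apply/eqP; rewrite -subr_eq0; move/eqP: E; rewrite -subr_eq0 /wedge => /eqP E;
    apply/eqP; rewrite -[RHS]E; ring.
(* The same comparison with [A i0] in place of [r2]; it serves to show that [h] lies in the ideal
   generated by [r1] and [r2]. *)
have [h' h'E] : exists h', forall j, A i0 * al j - r1%:P * B i0 j = h' * A j.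
  apply: exact1 => i j.
  have E : A i0 * wedge A al i j = r1%:P * (A i * B i0 j - A j * B i0 i).
    by rewrite -r1B -AlB; ring.
  by apply/eqP; rewrite -subr_eq0; move/eqP: E; rewrite -subr_eq0 /wedge => /eqP E;
    apply/eqP; rewrite -[RHS]E; ring.
have [s [t hst]] : exists s t, h = r1%:P * s + r2%:P * t.
  have [q qE] : exists q, al i0 - h' = r1%:P * q.
    apply: (@unit_lead_div_const _ (A i0) r1 _ (B i0 i0)) => //.
    by have := h'E i0 => E; rewrite mulrBr [A i0 * h']mulrC -E; ring.
  apply: (@unit_lead_div_const2 _ (A i0) _ r1 r2 (r2%:P * q - be i0) h') => //.
  have -> : A i0 * h = r2%:P * (al i0 - h') + r2%:P * h' - r1%:P * be i0.
    by rewrite mulrC -hE; ring.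
  by rewrite qE; ring.
(* With h = r1 s + r2 t, the product of [r2] and [al j - t * A j] is a multiple of [r1], and [r2] is
   regular modulo [r1]. *)
have [al' al'E] : exists al', forall j, al j - t * A j = r1%:P * al' j.
  have H j : exists q, al j - t * A j = r1%:P * q.
    apply: const_dvd_coef => i; apply: (cop _ ((s * A j + be j)`_i)).
    rewrite -!coefCM; suff -> : r2%:P * (al j - t * A j) = r1%:P * (s * A j + be j) by [].
    have -> : r2%:P * (al j - t * A j) = (r2%:P * al j - r1%:P * be j) + r1%:P * be j - r2%:P * t * A j by ring.
    by rewrite hE hst; ring.
  exists (fun j => proj1_sig (constructive_indefinite_description _ (H j))) => j.
  by case: constructive_indefinite_description.
exists al' => i j; have r1P : r1%:P != 0 by rewrite polyC_eq0.
apply: (mulfI r1P); rewrite r1B /wedge.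
have alE l : al l = r1%:P * al' l + t * A l by rewrite -al'E; ring.
by rewrite !alE; ring.
Qed.

End Koszul.

(** * Linear changes of coordinates *)

Section Mpoly.

Lemma mpoly_rmorph_ext (R S : comNzRingType) (n : nat)
    (f g : {rmorphism {mpoly R[n]} -> S}) :
  (forall c, f c%:MP = g c%:MP) -> (forall i, f 'X_i = g 'X_i) -> f =1 g.
Proof.
move=> fgC fgX p; rewrite [p]mpolyE !rmorph_sum; apply: eq_bigr => m _.
rewrite -mul_mpolyC !rmorphM fgC mpolyXE_id !rmorph_prod /=; congr (_ * _).
by apply: eq_bigr => i _; rewrite !rmorphXn /= fgX.
Qed.

Lemma mcoeff_pihomog (R : comNzRingType) (n d : nat) (p : {mpoly R[n]}) m :
  (pihomog mdeg d p)@_m = if mdeg m == d then p@_m else 0.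
Proof.
rewrite pihomogE [in RHS](mpolyE p).
rewrite (big_morph _ (mcoeffD m) (mcoeff0 _ _)) (big_morph _ (mcoeffD m) (mcoeff0 _ _)).
case: eqP => [e|ne].
  rewrite big_mkcond; apply: eq_bigr => m' _; case: eqP => // ne.
  by rewrite mcoeffZ mcoeffX; case: eqP => [E|]; [by case: ne; rewrite E | rewrite mulr0].
apply: big1 => m' /eqP e; rewrite mcoeffZ mcoeffX.
by case: eqP => [E|]; [rewrite -E e in ne | rewrite mulr0].
Qed.

Lemma mevalZ_homog (R : comNzRingType) (n d : nat) (p : {mpoly R[n]}) t v :
  p \is d.-homog -> p.@[fun i => t * v i] = t ^+ d * p.@[v].
Proof.
move=> /dhomogP hp; rewrite !mevalE mulr_sumr big_seq [RHS]big_seq.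
apply: eq_bigr => m mp; rewrite -(hp _ mp) mulrCA; congr (_ * _).
rewrite -[X in _ = t ^+ X * _]/(mdeg m) mdegE -prodrXr -big_split; apply: eq_bigr => i _ /=.
by rewrite exprMn.
Qed.

End Mpoly.

Section Shear.

Variables (k : comNzRingType) (n : nat) (c : 'I_n -> k).

(** The last coordinate becomes the variable of a univariate polynomial ring over the others, which
    are moved along it with slopes [c]; suitable slopes make a given nonzero polynomial monic up to
    a unit. *)
Definition shear_gen (i : 'I_n.+1) : {poly {mpoly k[n]}} :=
  if unlift ord_max i is Some j then ('X_j)%:P + ((c j)%:MP)%:P * 'X else 'X.

Definition shear : {mpoly k[n.+1]} -> {poly {mpoly k[n]}} :=
  mmap (polyC \o @mpolyC n k) shear_gen.

HB.instance Definition _ := GRing.RMorphism.on shear.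

Definition unshear_gen (j : 'I_n) : {mpoly k[n.+1]} :=
  'X_(lift ord_max j) - (c j)%:MP * 'X_ord_max.

Definition unshear : {poly {mpoly k[n]}} -> {mpoly k[n.+1]} :=
  horner_eval 'X_ord_max \o map_poly (mmap (@mpolyC n.+1 k) unshear_gen).

HB.instance Definition _ := GRing.RMorphism.on unshear.

Definition shear_pt (a : 'I_n -> k) (w : k) (i : 'I_n.+1) : k :=
  if unlift ord_max i is Some j then a j + c j * w else w.

Lemma shearD : {morph shear : p q / p + q}. Proof. exact: rmorphD. Qed.
Lemma shearN : {morph shear : p / - p}. Proof. exact: rmorphN. Qed.
Lemma shearM : {morph shear : p q / p * q}. Proof. exact: rmorphM. Qed.
Lemma shear0 : shear 0 = 0. Proof. exact: rmorph0. Qed.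
Lemma unshearD : {morph unshear : p q / p + q}. Proof. exact: rmorphD. Qed.
Lemma unshearN : {morph unshear : p / - p}. Proof. exact: rmorphN. Qed.
Lemma unshearM : {morph unshear : p q / p * q}. Proof. exact: rmorphM. Qed.

Lemma shearC a : shear a%:MP = a%:MP%:P.
Proof. by rewrite /shear mmapC. Qed.

Lemma shearX i : shear 'X_i = shear_gen i.
Proof. by rewrite /shear mmapX mmap1U. Qed.

Lemma shear_gen_max : shear_gen ord_max = 'X.
Proof. by rewrite /shear_gen unlift_none. Qed.

Lemma shear_gen_lift j : shear_gen (lift ord_max j) = ('X_j)%:P + ((c j)%:MP)%:P * 'X.
Proof. by rewrite /shear_gen liftK. Qed.

Lemma unshearC p : unshear p%:P = mmap (@mpolyC n.+1 k) unshear_gen p.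
Proof. by rewrite /unshear /= map_polyC /horner_eval hornerC. Qed.

Lemma unshearX : unshear 'X = 'X_ord_max.
Proof. by rewrite /unshear /= map_polyX /horner_eval hornerX. Qed.

Lemma shearK : cancel shear unshear.
Proof.
apply: (@mpoly_rmorph_ext _ _ _ (unshear \o shear) idfun) => [a|i] /=.
  by rewrite shearC unshearC mmapC.
rewrite shearX; case: (unliftP ord_max i) => [j|] ->.
  rewrite shear_gen_lift rmorphD rmorphM /= !unshearC unshearX mmapC mmapX mmap1U.
  by rewrite /unshear_gen subrK.
by rewrite shear_gen_max unshearX.
Qed.

Lemma unshearK : cancel unshear shear.
Proof.
have H p : shear (unshear p%:P) = p%:P.
  apply: (@mpoly_rmorph_ext _ _ _ (shear \o (unshear \o polyC)) polyC) => [a|i] /=.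
    by rewrite unshearC mmapC shearC.
  rewrite unshearC mmapX mmap1U /unshear_gen rmorphB rmorphM /= shearC !shearX.
  by rewrite shear_gen_lift shear_gen_max addrK.
elim/poly_ind => [|p a IH]; first by rewrite !rmorph0.
by rewrite !rmorphD !rmorphM /= IH H unshearX shearX shear_gen_max.
Qed.

Lemma unshear_wedge p q f g :
  unshear (shear p * f - shear q * g) = p * unshear f - q * unshear g.
Proof. by rewrite unshearD unshearN !unshearM !shearK. Qed.

Lemma meval_shear_pt p a w : p.@[shear_pt a w] = (map_poly (meval a) (shear p)).[w].
Proof.
apply: (@mpoly_rmorph_ext _ _ _ (meval (shear_pt a w))
  (horner_eval w \o (map_poly (meval a) \o shear))) => [b|i] /=.
  by rewrite shearC map_polyC /horner_eval hornerC /= !mevalC.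
rewrite shearX mevalXU /shear_pt; case: (unliftP ord_max i) => [j|] ->.
  rewrite shear_gen_lift rmorphD rmorphM /= !map_polyC map_polyX /horner_eval !hornerE /=.
  by rewrite mevalC mevalXU.
by rewrite shear_gen_max map_polyX /horner_eval hornerX.
Qed.

Lemma shear_pt_eq0 a w : (forall i, shear_pt a w i = 0) -> forall j, a j = 0.
Proof.
move=> H j; have := H ord_max; rewrite /shear_pt unlift_none => w0.
by have := H (lift ord_max j); rewrite /shear_pt liftK w0 mulr0 addr0.
Qed.

(** The size is only bounded above, so that the notion is multiplicative even when [a] vanishes. *)
Definition top_coef (d : nat) (p : {poly {mpoly k[n]}}) (a : {mpoly k[n]}) :=
  (size p <= d.+1)%N /\ p`_d = a.

Lemma top_coefM d e p q a b :
  top_coef d p a -> top_coef e q b -> top_coef (d + e) (p * q) (a * b).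
Proof.
move=> [sp pa] [sq qb]; split.
  by apply: leq_trans (size_polyMleq _ _) _; lia.
have dlt : (d < (d + e).+1)%N by rewrite ltnS leq_addr.
rewrite coefM (bigD1 (Ordinal dlt)) //= addKn pa qb big1 ?addr0 // => i ne.
case: (ltngtP i d) => [lt|gt|E]; last by rewrite -val_eqE /= E eqxx in ne.
  rewrite [q`__]nth_default ?mulr0 //; apply: leq_trans sq _.
  by lia.
by rewrite nth_default ?mul0r //; apply: leq_trans sp _.
Qed.

Lemma top_coefX d p a i : top_coef d p a -> top_coef (d * i) (p ^+ i) (a ^+ i).
Proof.
move=> H; elim: i => [|i IH]; last by rewrite mulnS !exprS; apply: top_coefM.
by rewrite muln0 !expr0; split; rewrite ?size_poly1 // coefC.
Qed.

(** The direction (c, 1) of the shear: the value there of the component of degree d is the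
    coefficient of ['X^d] after the shear, for polynomials of degree at most d. *)
Definition shear_dir (i : 'I_n.+1) : k := if unlift ord_max i is Some j then c j else 1.

Lemma shear_monomial m :
  top_coef (mdeg m) (shear 'X_[m]) ((\prod_i shear_dir i ^+ m i)%:MP).
Proof.
rewrite mpolyXE_id rmorph_prod rmorph_prod mdegE /=.
elim/big_rec3: _ => [|i d p a _ H]; first by split; rewrite ?size_poly1 ?coefC.
apply: (fun h => top_coefM h H); rewrite !rmorphXn /= -[X in top_coef X]mul1n.
apply: top_coefX.
rewrite shearX /shear_dir; case: (unliftP ord_max i) => [j|] ->; last first.
  by rewrite shear_gen_max; split; rewrite ?size_polyX ?coefX.
rewrite shear_gen_lift; split; last by rewrite coefD coefC coefCM coefX /= mulr1 add0r.
rewrite (leq_trans (size_polyD _ _)) // geq_max (leq_trans (size_polyC_leq1 _)) //=.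
by rewrite (leq_trans (size_polyMleq _ _)) // size_polyX addn2 /= ltnS size_polyC_leq1.
Qed.

Lemma shear_top_coef d p : (msize p <= d.+1)%N ->
  top_coef d (shear p) ((pihomog mdeg d p).@[shear_dir]%:MP).
Proof.
move=> sp; rewrite pihomogE {1}[p]mpolyE; split.
  rewrite rmorph_sum /=; apply: leq_trans (size_sum _ _ _) _.
  apply/bigmax_leqP_seq => m mp _; rewrite -mul_mpolyC rmorphM /= shearC mul_polyC.
  apply: leq_trans (size_scale_leq _ _) _.
  apply: leq_trans (proj1 (shear_monomial m)) _.
  by apply: leq_trans sp; apply: msize_mdeg_lt.
have -> : (\sum_(m <- msupp p | mdeg m == d) p@_m *: 'X_[m]).@[shear_dir] =
    \sum_(m <- msupp p | mdeg m == d) (p@_m *: 'X_[m]).@[shear_dir] by apply: raddf_sum.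
rewrite [shear _]rmorph_sum [(\sum_(m <- _ | _) _)%:MP]rmorph_sum /= coef_sum.
rewrite [RHS]big_mkcond [LHS]big_seq [RHS]big_seq /=.
apply: eq_bigr => m mp; rewrite -mul_mpolyC rmorphM /= shearC coefCM.
have [sm cm] := shear_monomial m.
case: eqP => [<-|ne]; first by rewrite cm rmorphM /= mevalC mevalX mpolyCM.
rewrite nth_default ?mulr0 //; apply: leq_trans sm _.
have := leq_trans (msize_mdeg_lt mp) sp; rewrite ltnS leq_eqVlt => /orP[/eqP //|].
by [].
Qed.

End Shear.

(** * Nonvanishing points and normalization over an algebraically closed field *)

Section ClosedField.

Variable k : closedFieldType.

(** For nonconstant [p], a root of [p - 1] will do. *)
Lemma poly_nonroot (p : {poly k}) : p != 0 -> exists w, p.[w] != 0.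
Proof.
move=> p0; have [s1|s1] := leqP (size p) 1.
  exists 0; move: p0; rewrite (size1_polyC s1) hornerC; by rewrite polyC_eq0.
have s2 : size (p - 1) = size p by rewrite size_polyDl // size_polyN size_poly1.
have [|w /rootP] := closed_rootP (p - 1) _; first by rewrite s2 gtn_eqF.
rewrite !hornerE => /eqP; rewrite subr_eq0 => /eqP E.
by exists w; rewrite E oner_neq0.
Qed.

Lemma mpoly_nonroot n (p : {mpoly k[n]}) : p != 0 -> exists v, p.@[v] != 0.
Proof.
elim: n p => [|n IH] p p0.
  by exists (fun _ => 0); move: p0; rewrite (nvar0_mpolyC p) mevalC mpolyC_eq0.
have s0 : shear (fun _ => 0) p != 0.
  by apply: contraNneq p0 => E; rewrite -(shearK (fun _ => 0) p) E rmorph0.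
have [a a0] := IH _ (eq_ind_r (fun b => ~~ b) s0 (lead_coef_eq0 _)).
have [|w w0] := @poly_nonroot (map_poly (meval a) (shear (fun _ => 0) p)).
  by rewrite map_poly_eq0_id0.
by exists (shear_pt (fun _ => 0) a w); rewrite meval_shear_pt.
Qed.

Lemma shear_unit_lead n (p : {mpoly k[n.+1]}) : p != 0 ->
  exists c, unit_lead (shear c p).
Proof.
move=> p0; pose d := (msize p).-1; have sp : msize p = d.+1 by rewrite -mpolySpred.
pose t := pihomog mdeg d p.
have t0 : t != 0.
  apply: contraNneq (p0) => /(congr1 (mcoeff (mlead p))).
  rewrite mcoeff_pihomog mcoeff0 -mleadc_eq0 => <-.
  suff -> : mdeg (mlead p) = d by rewrite eqxx.
  by apply: succn_inj; rewrite mlead_deg.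
(* The factor ['X_ord_max] keeps the last coordinate of [v] nonzero, so that [v] can be rescaled to
   [shear_dir c]. *)
have [|v] := @mpoly_nonroot _ (t * 'X_ord_max).
  by rewrite mulf_neq0 // -(msize_poly_eq0) msizeX.
rewrite mevalM mevalXU mulf_eq0 negb_or => /andP[tv v0].
pose c j := v (lift ord_max j) / v ord_max; exists c.
have tc : t.@[shear_dir c] != 0.
  apply: contraNneq tv => E.
  have -> : t.@[v] = t.@[fun i => v ord_max * shear_dir c i].
    apply: meval_eq => i; rewrite /shear_dir; case: (unliftP ord_max i) => [j|] ->.
      by rewrite /c mulrC divfK.
    by rewrite mulr1.
  by rewrite (@mevalZ_homog _ _ d) ?pihomogP // E mulr0.
have [|sz cf] := @shear_top_coef _ _ c d p; first by rewrite sp.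
have sE : size (shear c p) = d.+1.
  apply/eqP; rewrite eqn_leq sz ltnNge; apply/negP => /leq_sizeP/(_ d (leqnn d)).
  by rewrite cf => /eqP; rewrite mpolyC_eq0; apply/negP.
rewrite /unit_lead lead_coefE sE cf /=.
by apply: rmorph_unit; rewrite unitfE.
Qed.

End ClosedField.

(** * Algebraic dependence on a set of points *)

Section Dependence.

Variables (k : closedFieldType) (n : nat).
Implicit Types (Z C : ('I_n -> k) -> Prop).

Lemma meval_mmap q (y : 'I_q -> {mpoly k[n]}) (F : {mpoly k[q]}) v :
  (mmap (@mpolyC n k) y F).@[v] = F.@[fun i => (y i).@[v]].
Proof.
apply: (@mpoly_rmorph_ext _ _ _ (meval v \o mmap (@mpolyC n k) y) (meval _)) => [c|i] /=.
  by rewrite mmapC !mevalC.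
by rewrite mmapX mmap1U mevalXU.
Qed.

(** Dimension is measured by the transcendence degree of the polynomial functions restricted to [Z],
    which makes sense for any set of points. *)
Definition dim_lt q Z := forall y : 'I_q -> {mpoly k[n]},
  exists2 F : {mpoly k[q]}, F != 0 &
    forall v, Z v -> F.@[fun i => (y i).@[v]] = 0.

Lemma dim_lt_sub q Z C : (forall v, Z v -> C v) -> dim_lt q C -> dim_lt q Z.
Proof. by move=> ZC H y; have [F F0 FC] := H y; exists F => // v /ZC/FC. Qed.

(** A relation between [y] and [g] on [C'] is read as a polynomial in [g]. Factors [g] cancel on
    [C'] until the constant term is nonzero; on [C], where [g] vanishes, this term is a relation
    between the [y i]. *)
Lemma dim_lt_step q C C' (g : {mpoly k[n]}) :
  (forall v, C v -> C' v) -> (forall v, C v -> g.@[v] = 0) ->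
  (forall h : {mpoly k[n]}, (forall v, C' v -> h.@[v] * g.@[v] = 0) ->
     forall v, C' v -> h.@[v] = 0) ->
  dim_lt q.+1 C' -> dim_lt q C.
Proof.
move=> CC' gC gC' H y.
have [F F0 FC] := H (fun i => if unlift ord_max i is Some j then y j else g).
pose P := shear (fun _ => 0) F.
have P0 : P != 0.
  by apply: contraNneq F0 => E; rewrite -(shearK (fun _ => 0) F) -/P E rmorph0.
pose ev v (Q : {poly {mpoly k[q]}}) := (map_poly (meval (fun i => (y i).@[v])) Q).[g.@[v]].
have PC v : C' v -> ev v P = 0.
  move=> /FC <-; rewrite /ev -meval_shear_pt; apply: meval_eq => i.
  by rewrite /shear_pt; case: (unlift ord_max i) => [j|]; rewrite ?mul0r ?addr0.
elim/poly_ind: P P0 PC => [|P c IH]; first by rewrite eqxx.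
have evE v : ev v (P * 'X + c%:P) = ev v P * g.@[v] + c.@[fun i => (y i).@[v]].
  by rewrite /ev rmorphD rmorphM /= map_polyX map_polyC hornerMXaddC.
case: (eqVneq c 0) => [c0|c0] P0 PC; last first.
  exists c => // v Cv; have := PC v (CC' v Cv).
  by rewrite evE gC // mulr0 add0r.
apply: IH => [|v C'v].
  by apply: contraNneq P0 => ->; rewrite c0 mul0r addr0.
pose h := (map_poly (mmap (@mpolyC n k) y) P).[g].
have hE u : h.@[u] = ev u P.
  rewrite /h /ev -horner_map -map_poly_comp; congr _.[_].
  by apply: eq_map_poly => f /=; apply: meval_mmap.
rewrite -hE; apply: gC' => // u /PC; by rewrite evE c0 meval0 addr0 hE.
Qed.

Lemma msizeM_leq (p r : {mpoly k[n]}) a b :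
  (msize p <= a.+1)%N -> (msize r <= b.+1)%N -> (msize (p * r) <= (a + b).+1)%N.
Proof.
have [->|p0] := eqVneq p 0; first by rewrite mul0r msize0.
have [->|r0] := eqVneq r 0; first by rewrite mulr0 msize0.
rewrite msizeM // => pa rb; rewrite -ltnS prednK ?addn_gt0.
  by rewrite -addnS -addSn leq_add.
by rewrite lt0n msize_poly_eq0 p0.
Qed.

Lemma msize_prod_exp q D (y : 'I_q -> {mpoly k[n]}) (u : 'I_q -> nat) N m :
  (forall i, (msize (y i) <= D.+1)%N) -> (forall i, (u i <= N)%N) ->
  (q * (N * D) < mdeg m)%N -> (\prod_i y i ^+ u i)@_m = 0.
Proof.
move=> yD uN lt; apply: memN_msupp_eq0; apply: msize_mdeg_ge.
suff H : (msize (\prod_i y i ^+ u i) <= (\sum_(i < q) N * D).+1)%N.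
  apply: leq_trans H _; by rewrite sum_nat_const card_ord.
have exps i : (msize (y i ^+ u i) <= (N * D).+1)%N.
  apply: (@leq_trans (u i * D).+1); last by rewrite ltnS leq_mul2r uN orbT.
  elim: (u i) => [|e IH]; first by rewrite expr0 msize1.
  by rewrite exprS mulSn; apply: msizeM_leq.
elim/big_rec2: _ => [|i s p _ IH]; first by rewrite msize1.
exact: msizeM_leq.
Qed.

Lemma dim_lt_full : dim_lt n.+1 (fun _ => True).
Proof.
move=> y; pose D := (\max_i msize (y i))%N.
have yD i : (msize (y i) <= D.+1)%N by apply: leqW; exact: leq_bigmax.
(* [M] exceeds the degrees of these products, and M <= c N, so that M^n <= c^n N^n < N^(n+1). *)
pose c := (n.+1 * D).+1; pose N := (c ^ n).+1; pose M := (n.+1 * (N * D)).+1.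
pose rowT := {ffun 'I_n.+1 -> 'I_N}; pose colT := {ffun 'I_n -> 'I_M}.
have card_lt : (#|colT| < #|rowT|)%N.
  rewrite !card_ffun !card_ord; apply: (@leq_ltn_trans ((c * N) ^ n)).
    by case: (n) => // n'; rewrite leq_exp2r // /M /c /N; nia.
  by rewrite expnMn expnS ltn_mul2r expn_gt0 /= /N ltnSn.
pose mnm_of (w : colT) : 'X_{1..n} := [multinom (w j : nat) | j < n].
pose mon (u : rowT) : {mpoly k[n]} := \prod_i y i ^+ u i.
pose A := \matrix_(s < #|rowT|, t < #|colT|) (mon (enum_val s))@_(mnm_of (enum_val t)).
have [x x0 xA] : exists2 x : 'rV_#|rowT|, x != 0 & x *m A = 0.
  have : kermx A != 0.
    rewrite -mxrank_eq0 mxrank_ker subn_eq0 -ltnNge.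
    by apply: leq_ltn_trans card_lt; apply: rank_leq_col.
  case/rowV0Pn => x /sub_kermxP xA x0; by exists x.
pose mnm_of' (u : rowT) : 'X_{1..n.+1} := [multinom (u j : nat) | j < n.+1].
have mnm_inj : injective mnm_of'.
  move=> u1 u2 /mnmP E; apply/ffunP => i; apply/val_inj; have := E i.
  by rewrite !mnmE.
pose F : {mpoly k[n.+1]} := \sum_s x 0 s *: 'X_[mnm_of' (enum_val s)].
have Fc s : F@_(mnm_of' (enum_val s)) = x 0 s.
  rewrite /F raddf_sum (bigD1 s) //= mcoeffZ mcoeffX eqxx mulr1 big1 ?addr0 // => t ne.
  rewrite mcoeffZ mcoeffX; case: eqP => [/mnm_inj/enum_val_inj E|]; last by rewrite mulr0.
  by rewrite E eqxx in ne.
exists F => [|v _].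
  apply: contraNneq x0 => F0; apply/eqP/rowP => s.
  by rewrite -Fc F0 mcoeff0 mxE.
have -> : F.@[fun i => (y i).@[v]] = (\sum_s x 0 s *: mon (enum_val s)).@[v].
  rewrite /F !raddf_sum /=; apply: eq_bigr => s _.
  rewrite !mevalZ mevalX rmorph_prod /=; congr (_ * _); apply: eq_bigr => i _.
  by rewrite mnmE rmorphXn.
suff -> : \sum_s x 0 s *: mon (enum_val s) = 0 by rewrite meval0.
apply/mpolyP => m; rewrite mcoeff0 raddf_sum /=.
have [le|gt] := leqP (mdeg m) (n.+1 * (N * D)); last first.
  apply: big1 => s _; rewrite mcoeffZ /mon (@msize_prod_exp _ D _ _ N) ?mulr0 //.
  by move=> i; apply: ltnW.
have mM i : (m i < M)%N.
  rewrite ltnS; apply: leq_trans le; rewrite mdegE; by rewrite (bigD1 i) //= leq_addr.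
pose w : colT := [ffun j => Ordinal (mM j)].
have mE : m = mnm_of w by apply/mnmP => j; rewrite mnmE ffunE.
have := congr1 (fun B : 'rV_#|colT| => B 0 (enum_rank w)) xA.
rewrite !mxE => E; rewrite -[RHS]E; apply: eq_bigr => s _.
by rewrite mxE enum_rankK -mE mcoeffZ.
Qed.

End Dependence.

(** * Noetherianity of polynomial rings *)

Section Dickson.

Variable n : nat.

(** Each index is chosen to minimize [a] among all indices beyond the previous one. *)
Lemma nondecreasing_subseq (a : nat -> nat) :
  exists phi : nat -> nat, (forall i j, (i < j)%N -> (phi i < phi j)%N) /\
    (forall i j, (i <= j)%N -> (a (phi i) <= a (phi j))%N).
Proof.
have /(_ _)/constructive_indefinite_description g m :
    exists i, (m <= i)%N /\ forall j, (m <= j)%N -> (a i <= a j)%N.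
  have : exists i, (m <= i)%N by exists m.
  case=> i; move: {2}(a i) (erefl (a i)) => s; elim/ltn_ind: s i => s IH i si mi.
  case: (classic (exists2 j, (m <= j)%N & (a j < s)%N)) => [[j mj lt]|N].
    exact: IH lt _ erefl mj.
  exists i; split=> // j mj; rewrite leqNgt si; apply/negP => lt.
  by apply: N; exists j.
pose G m := proj1_sig (g m).
have G1 m : (m <= G m)%N by rewrite /G; case: (g m) => i [].
have G2 m j : (m <= j)%N -> (a (G m) <= a j)%N by rewrite /G; case: (g m) => i [_ gi] /=; apply: gi.
pose phi := fix phi i := if i is i'.+1 then G (phi i').+1 else G 0%N.
have phi1 i : (phi i < phi i.+1)%N by apply: leq_trans (G1 _).
have phil : forall i j, (i < j)%N -> (phi i < phi j)%N.
  move=> i; elim=> // j IH; rewrite ltnS leq_eqVlt => /orP[/eqP-> //|/IH lt].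
  exact: ltn_trans lt (phi1 _).
exists phi; split=> // i j; rewrite leq_eqVlt => /orP[/eqP -> //|lt].
case: i lt => [|i] lt; apply: G2 => //.
exact: ltn_trans (phi1 i) (phil _ _ lt).
Qed.

Lemma nondecreasing_subseq_mnm (s : nat -> 'X_{1..n}) :
  exists phi : nat -> nat, (forall i j, (i < j)%N -> (phi i < phi j)%N) /\
    (forall i j, (i <= j)%N -> (s (phi i) <= s (phi j))%MM).
Proof.
suff [phi [phil H]] : exists phi : nat -> nat,
    (forall i j, (i < j)%N -> (phi i < phi j)%N) /\
    (forall x, x \in enum 'I_n -> forall i j, (i <= j)%N -> (s (phi i) x <= s (phi j) x)%N).
  exists phi; split=> // i j ij; apply/mnm_lepP => x; apply: H => //.
  by rewrite mem_enum.
elim: (enum 'I_n) => [|x l [phi [phil H]]]; first by exists id.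
have [psi [psil Hx]] := nondecreasing_subseq (fun i => s (phi i) x).
exists (phi \o psi); split=> [i j ij|y]; first by apply: phil; apply: psil.
rewrite inE => /orP[/eqP ->|yl] i j ij; first exact: Hx.
apply: H => //; move: ij; rewrite leq_eqVlt => /orP[/eqP -> //|lt].
by apply: ltnW; apply: psil.
Qed.

(** Otherwise elements of [L] could be picked forever, none dominating an earlier one, against the
    existence of a nondecreasing subsequence. *)
Lemma dickson (L : 'X_{1..n} -> Prop) :
  exists l : seq 'X_{1..n}, (forall m, m \in l -> L m) /\
    (forall m, L m -> exists2 m', m' \in l & (m' <= m)%MM).
Proof.
apply: NNPP => N.
have pickP (l : seq 'X_{1..n}) : exists m, (forall m', m' \in l -> L m') ->
    L m /\ (forall m', m' \in l -> ~~ (m' <= m)%MM).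
  case: (classic (forall m', m' \in l -> L m')) => [lL|nl]; last by exists 0%MM.
  apply: NNPP => N'; apply: N; exists l; split=> // m Lm.
  apply: NNPP => N2; apply: N'; exists m => _; split=> // m' m'l; apply/negP => le.
  by apply: N2; exists m'.
pose pick l := proj1_sig (constructive_indefinite_description _ (pickP l)).
have pickH l : (forall m', m' \in l -> L m') ->
    L (pick l) /\ (forall m', m' \in l -> ~~ (m' <= pick l)%MM).
  by rewrite /pick; case: constructive_indefinite_description.
pose ls := fix ls j := if j is j'.+1 then pick (ls j') :: ls j' else [::].
have lsL j : forall m, m \in ls j -> L m.
  elim: j => //= j IH m; rewrite inE => /orP[/eqP ->|]; last exact: IH.
  by case: (pickH _ IH).
have mem i j : (i < j)%N -> pick (ls i) \in ls j.
  elim: j => // j IH; rewrite ltnS leq_eqVlt => /orP[/eqP ->|/IH]; rewrite /= inE ?eqxx //.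
  by move=> ->; rewrite orbT.
have [phi [phil H]] := nondecreasing_subseq_mnm (fun j => pick (ls j)).
have := H 0%N 1%N isT; apply/negP; have := mem _ _ (phil 0%N 1%N isT).
by case: (pickH _ (@lsL (phi 1%N))) => _; apply.
Qed.

End Dickson.

Section Noetherian.

Variables (k : fieldType) (n : nat) (f : nat -> {mpoly k[n]}).

Definition in_span N (g : {mpoly k[n]}) :=
  exists c : nat -> {mpoly k[n]}, g = \sum_(i < N) c i * f i.

Lemma in_spanD N g h : in_span N g -> in_span N h -> in_span N (g + h).
Proof.
move=> [c ->] [d ->]; exists (fun i => c i + d i).
by rewrite -big_split; apply: eq_bigr => i _; rewrite mulrDl.
Qed.

Lemma in_spanM N g h : in_span N h -> in_span N (g * h).
Proof.
move=> [d ->]; exists (fun i => g * d i).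
by rewrite mulr_sumr; apply: eq_bigr => i _; rewrite mulrA.
Qed.

Lemma in_span_widen N M g : (N <= M)%N -> in_span N g -> in_span M g.
Proof.
move=> NM [c ->]; exists (fun i => if (i < N)%N then c i else 0).
rewrite (big_ord_widen _ (fun i => c i * f i) NM) big_mkcond.
by apply: eq_bigr => i _; case: ifP => // _; rewrite mul0r.
Qed.

Lemma mlead_reduce (g h : {mpoly k[n]}) : g != 0 -> h != 0 -> (mlead h <= mlead g)%MM ->
  exists q, g - q * h = 0 \/ (mlead (g - q * h) < mlead g)%O.
Proof.
move=> g0 h0 le; pose c := g@_(mlead g) / h@_(mlead h).
have hc : h@_(mlead h) != 0 by rewrite mleadc_eq0.
have c0 : c != 0 by rewrite mulf_neq0 ?invr_eq0 // mleadc_eq0.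
pose m := (mlead g - mlead h)%MM; exists (c *: 'X_[m]).
have X0 : 'X_[k, m] != 0 by rewrite -msize_poly_eq0 msizeX.
have qE : mlead (c *: 'X_[m] * h) = mlead g.
  by rewrite -scalerAl mleadZ // mleadM // mleadXm /m submK.
have cE : (c *: 'X_[m] * h)@_(mlead g) = g@_(mlead g).
  by rewrite -scalerAl mcoeffZ ['X_[m] * h]mulrC -{1}(submK le) mcoeffMX /c divfK.
have [->|d0] := eqVneq (g - c *: 'X_[m] * h) 0; first by left.
right; have := mleadB_le g (c *: 'X_[m] * h); rewrite qE joinxx.
rewrite le_eqVlt => /orP[/eqP E|//].
by move: d0; rewrite -mleadc_eq0 E mcoeffB cE subrr eqxx.
Qed.

(** A Groebner basis argument: by Dickson's lemma, finitely many leading monomials divide all those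
    of the ideal of the [f i], and [N] is chosen so that they come from the span of the first [N]
    generators. Reduction, by induction on the leading monomial, puts the whole ideal in that
    span. *)
Lemma mpoly_noetherian : exists N, in_span N (f N).
Proof.
pose L m := exists g, [/\ exists N, in_span N g, g != 0 & mlead g = m].
have [l [lL Ll]] := dickson L.
have [N NP] : exists N, forall m, m \in l ->
    exists g, [/\ in_span N g, g != 0 & mlead g = m].
  elim: l lL {Ll} => [|m l IH] lL; first by exists 0%N.
  have [|N NP] := IH; first by move=> m' m'l; apply: lL; rewrite inE m'l orbT.
  have [|g [[M gM] g0 gm]] := lL m; first by rewrite inE eqxx.
  exists (maxn N M) => m'; rewrite inE => /orP[/eqP ->|/NP[h [hN h0 hm]]].
    by exists g; split=> //; apply: in_span_widen gM; rewrite leq_maxr.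
  by exists h; split=> //; apply: in_span_widen hN; rewrite leq_maxl.
exists N; suff H : forall m g M, mlead g = m -> in_span M g -> in_span N g.
  apply: (H _ (f N) N.+1 erefl); exists (fun i => (i == N)%:R).
  rewrite big_ord_recr /= eqxx mul1r big1 ?add0r // => i _.
  by rewrite ltn_eqF ?mul0r.
have sp0 : in_span N 0 by exists (fun _ => 0); rewrite big1 // => i _; rewrite mul0r.
move=> m; elim/(well_founded_ind (@ltom_wf n)): m => m IH g M gm gM.
have [->//|g0] := eqVneq g 0.
have [|m' m'l le] := Ll m; first by exists g; split=> //; exists M.
have [h [hN h0 hm]] := NP _ m'l; rewrite -hm -gm in le.
have [q qP] := mlead_reduce g0 h0 le.
have -> : g = (g - q * h) + q * h by rewrite subrK.
apply: in_spanD; last exact: in_spanM.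
case: qP => [->//|lt]; apply: (IH _ _ _ (maxn N M) erefl); first by rewrite -gm.
rewrite -mulNr; apply: in_spanD; first by apply: in_span_widen gM; rewrite leq_maxr.
by apply: in_spanM; apply: in_span_widen hN; rewrite leq_maxl.
Qed.

End Noetherian.

(** * Codimension in projective space *)

Section Topology.

Variables (k : closedFieldType) (n : nat).
Implicit Types (v : vec k n) (C W Z : vec k n -> Prop) (g h : {mpoly k[n.+1]}).

Local Notation subset := (@Pilot.Defs.subset k n).
Local Notation proj := (@proj_space k n).

Lemma proj_spaceZ v t : t != 0 -> proj v -> proj (fun i => t * v i).
Proof. by move=> t0 [i vi]; exists i; rewrite mulf_neq0. Qed.

Lemma proj_closed_sub Z v : proj_closed Z -> Z v -> proj v.
Proof. by move=> [S [_ H]] /H[]. Qed.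

Lemma proj_closed_cone Z v t : proj_closed Z -> t != 0 -> Z v -> Z (fun i => t * v i).
Proof.
move=> [S [Sh H]] t0 /H[pv Sv]; apply/H; split; first exact: proj_spaceZ.
by move=> g Sg; have [e ge] := Sh _ Sg; rewrite (mevalZ_homog _ _ ge) Sv ?mulr0.
Qed.

Lemma proj_closedI Z1 Z2 : proj_closed Z1 -> proj_closed Z2 ->
  proj_closed (fun v => Z1 v /\ Z2 v).
Proof.
move=> [S1 [S1h H1]] [S2 [S2h H2]]; exists (fun g => S1 g \/ S2 g); split.
  by move=> g [/S1h|/S2h].
move=> v; rewrite H1 H2; split=> [[[pv h1] [_ h2]]|[pv H]].
  by split=> // g [/h1|/h2].
by split; split=> // g Sg; apply: H; [left | right].
Qed.

Lemma proj_closed_zeros g e : g \is e.-homog -> proj_closed (fun v => proj v /\ g.@[v] = 0).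
Proof.
move=> ge; exists (fun h => h = g); split=> [h ->|v]; first by exists e.
by split=> -[pv H]; split=> //; [move=> h -> | apply: H].
Qed.

Lemma closed_in_proj Z : proj_closed Z -> closed_in proj Z.
Proof.
by move=> cZ; exists Z => // v; split=> [Zv|[]//]; split=> //; apply: proj_closed_sub Zv.
Qed.

Lemma proj_closed_ext Z Z' : proj_closed Z -> (forall v, Z' v <-> Z v) -> proj_closed Z'.
Proof. by move=> [S [Sh H]] E; exists S; split=> // v; rewrite E. Qed.

Lemma proj_closed_of_in Z : closed_in proj Z -> proj_closed Z.
Proof.
move=> [Z' cZ' H]; apply: (proj_closed_ext cZ') => v; rewrite H.
by split=> [[]//|Z'v]; split=> //; apply: proj_closed_sub Z'v.
Qed.

Lemma proj_closed_sep Z v : proj_closed Z -> proj v -> ~ Z v ->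
  exists g e, [/\ g \is e.-homog, g.@[v] != 0 & forall u, Z u -> g.@[u] = 0].
Proof.
move=> [S [Sh H]] pv nZ; apply: NNPP => N; apply: nZ; apply/H; split=> // g Sg.
apply/eqP; apply: contra_notT N => gv; have [e ge] := Sh _ Sg.
by exists g, e; split=> // u /H[_]; apply.
Qed.

Lemma irreducible_prime C g h d e :
  irreducible_closed_in proj C -> g \is d.-homog -> h \is e.-homog ->
  (forall v, C v -> g.@[v] * h.@[v] = 0) ->
  (forall v, C v -> g.@[v] = 0) \/ (forall v, C v -> h.@[v] = 0).
Proof.
move=> [/proj_closed_of_in cC _ irr] gd he gh.
case: (irr _ _ (closed_in_proj (proj_closed_zeros gd)) (closed_in_proj (proj_closed_zeros he))).
- move=> v Cv; have pv := proj_closed_sub cC Cv.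
  by move/eqP: (gh v Cv); rewrite mulf_eq0 => /orP[] /eqP E; [left | right].
- by left=> v /a[].
- by right=> v /b[].
Qed.

Lemma meval_pihomog h v :
  h.@[v] = \sum_(d < msize h) (pihomog mdeg d h).@[v].
Proof.
by rewrite {1}(pihomog_partitionE (leqnn (msize h))) raddf_sum.
Qed.

(** Along the ray [h] is a polynomial [H1] in t, with the values of the homogeneous components as
    coefficients; the factor ['X] takes care of t = 0. *)
Lemma pihomog_eq0_ray h v : (forall t, t != 0 -> h.@[fun i => t * v i] = 0) ->
  forall d, (pihomog mdeg d h).@[v] = 0.
Proof.
move=> H d; pose H1 := \poly_(e < msize h) (pihomog mdeg e h).@[v].
have hE t : H1.[t] = h.@[fun i => t * v i].
  rewrite horner_poly meval_pihomog.
  by apply: eq_bigr => e _; rewrite (@mevalZ_homog _ _ e) ?pihomogP // mulrC.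
have H10 : H1 * 'X = 0.
  apply/eqP/negPn/negP => /poly_nonroot[w]; rewrite hornerMX mulf_eq0 negb_or.
  by move=> /andP[] /[swap] w0; rewrite hE H ?eqxx.
have {}H10 : H1 = 0.
  by move/eqP: H10; rewrite mulf_eq0 polyX_eq0 orbF => /eqP.
have [lt|le] := ltnP d (msize h).
  by have := congr1 (fun p : {poly k} => p`_d) H10; rewrite coef_poly lt coef0.
suff -> : pihomog mdeg d h = 0 by rewrite meval0.
apply/mpolyP => m; rewrite mcoeff_pihomog mcoeff0; case: eqP => // md.
by apply: memN_msupp_eq0; apply: msize_mdeg_ge; rewrite /= md.
Qed.

(** For homogeneous [h] this is the primality of the ideal of [C]. As [C] is a cone, the general
    case follows one homogeneous component at a time. *)
Lemma irreducible_nonzerodivisor C g e : irreducible_closed_in proj C ->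
  g \is e.-homog -> (exists2 v, C v & g.@[v] != 0) ->
  forall h, (forall v, C v -> h.@[v] * g.@[v] = 0) -> forall v, C v -> h.@[v] = 0.
Proof.
move=> irrC ge [u Cu gu] h hg v Cv.
have cC : proj_closed C by case: irrC => /proj_closed_of_in.
rewrite meval_pihomog big1 // => d _.
have hd : pihomog mdeg d h \is d.-homog by apply: pihomogP.
case: (irreducible_prime irrC hd ge) => [w Cw|H|H]; last by rewrite H ?eqxx in gu.
  have [->|gw] := eqVneq g.@[w] 0; first by rewrite mulr0.
  rewrite (@pihomog_eq0_ray h) ?mul0r // => t t0.
  have /eqP := hg _ (proj_closed_cone cC t0 Cw).
  by rewrite (mevalZ_homog t w ge) !mulf_eq0 expf_eq0 (negPf t0) andbF (negPf gw) /= orbF => /eqP.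
exact: H.
Qed.

(** Each strict inclusion lowers the dimension, through a form vanishing on the smaller set but not
    on the larger. The total is n + 2 because the sets are cones in dimension n + 1 and the bound is
    strict. *)
Lemma dim_lt_chain c q (chain : nat -> vec k n -> Prop) : (q + c = n.+2)%N ->
  (forall i, (i <= c)%N -> irreducible_closed_in proj (chain i)) ->
  (forall i, (i < c)%N ->
     subset (chain i) (chain i.+1) /\ ~ subset (chain i.+1) (chain i)) ->
  dim_lt q (chain 0%N).
Proof.
elim: c q chain => [|c IH] q chain qc irr strict.
  by rewrite addn0 in qc; rewrite qc; apply: dim_lt_sub (@dim_lt_full k n.+1).
have dim1 : dim_lt q.+1 (chain 1%N).
  apply: (IH _ (fun i => chain i.+1)) => [|i ic|i ic]; first by rewrite addSnnS.
    exact: irr.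
  exact: strict.
have [sub nsub] := strict 0%N isT.
have [v C1v nC0v] : exists2 v, chain 1%N v & ~ chain 0%N v.
  apply: NNPP => N; apply: nsub => v C1v; apply: NNPP => nC0v.
  by apply: N; exists v.
have irr1 := irr 1%N isT.
have c1 : proj_closed (chain 1%N) by case: irr1 => /proj_closed_of_in.
have c0 : proj_closed (chain 0%N) by case: (irr 0%N isT) => /proj_closed_of_in.
have [g [e [ge gv g0]]] := proj_closed_sep c0 (proj_closed_sub c1 C1v) nC0v.
apply: dim_lt_step sub g0 _ dim1.
by apply: (irreducible_nonzerodivisor irr1 ge); exists v.
Qed.

(* Noetherian induction: a minimal closed set on which the family [y] is
   algebraically independent would be irreducible. *)
Lemma dim_lt_irreducible q Z : proj_closed Z ->
  (forall W, irreducible_closed_in proj W -> subset W Z -> dim_lt q W) ->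
  dim_lt q Z.
Proof.
move=> cZ irrZ y.
pose dep W := exists2 F : {mpoly k[q]}, F != 0 &
  forall v, W v -> F.@[fun i => (y i).@[v]] = 0.
apply: NNPP => ndepZ.
pose good W := [/\ proj_closed W, subset W Z & ~ dep W].
have split W : good W -> exists x : (vec k n -> Prop) * {mpoly k[n.+1]} * vec k n,
    let: (W', g, v) := x in
    [/\ good W', subset W' W, W v, g.@[v] != 0 & forall u, W' u -> g.@[u] = 0].
  move=> [cW WZ ndepW].
  have aux Z1 : closed_in proj Z1 -> ~ subset W Z1 -> ~ dep (fun v => W v /\ Z1 v) ->
      exists x : (vec k n -> Prop) * {mpoly k[n.+1]} * vec k n,
        let: (W', g, v) := x in
        [/\ good W', subset W' W, W v, g.@[v] != 0 & forall u, W' u -> g.@[u] = 0].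
    move=> /proj_closed_of_in cZ1 nsub nd.
    have [v Wv nZ1] : exists2 v, W v & ~ Z1 v.
      apply: NNPP => N; apply: nsub => v Wv; apply: NNPP => nZ1.
      by apply: N; exists v.
    have [g [e [ge gv g0]]] := proj_closed_sep cZ1 (proj_closed_sub cW Wv) nZ1.
    exists ((fun v => W v /\ Z1 v), g, v); split=> //; last by move=> u [_ /g0].
      by split=> //; [apply: proj_closedI | move=> u [/WZ]].
    by move=> u [].
  have neW : exists v, W v.
    apply: NNPP => N; apply: ndepW; exists 1; first exact: oner_neq0.
    by move=> v Wv; case: N; exists v.
  apply: NNPP => N; apply: (ndepW); apply: (irrZ W _ WZ).
  split=> // [|Z1 Z2 cZ1 cZ2 sub]; first exact: closed_in_proj.
  apply: NNPP => /not_or_and[n1 n2]; apply: N.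
  case: (classic (dep (fun v => W v /\ Z1 v))) => [[F1 F10 F1E]|]; last exact: aux.
  case: (classic (dep (fun v => W v /\ Z2 v))) => [[F2 F20 F2E]|]; last exact: aux.
  case: ndepW; exists (F1 * F2); first by rewrite mulf_neq0.
  move=> v Wv; rewrite mevalM; case: (sub v Wv) => Zv.
    by rewrite F1E ?mul0r.
  by rewrite F2E ?mulr0.
have [next nextP] : exists next, forall W, good W -> let: (W', g, v) := next W in
    [/\ good W', subset W' W, W v, g.@[v] != 0 & forall u, W' u -> g.@[u] = 0].
  have H W : exists x : (vec k n -> Prop) * {mpoly k[n.+1]} * vec k n, good W ->
      let: (W', g, v) := x in
      [/\ good W', subset W' W, W v, g.@[v] != 0 & forall u, W' u -> g.@[u] = 0].
    case: (classic (good W)) => [/split[x xP]|ng]; first by exists x.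
    by exists (W, 0, fun _ => 0).
  exists (fun W => proj1_sig (constructive_indefinite_description _ (H W))) => W.
  by case: constructive_indefinite_description.
pose Ws := fix Ws j := if j is j'.+1 then (next (Ws j')).1.1 else Z.
pose gs j := (next (Ws j)).1.2; pose vs j := (next (Ws j)).2.
have goodW j : good (Ws j).
  elim: j => [|j /nextP /=]; first by split=> // v.
  by case: (next (Ws j)) => [[W' g] v] [].
have WS j : [/\ subset (Ws j.+1) (Ws j), Ws j (vs j), (gs j).@[vs j] != 0 &
    forall u, Ws j.+1 u -> (gs j).@[u] = 0].
  have := nextP _ (goodW j); rewrite /gs /vs /=.
  by case: (next (Ws j)) => [[W' g] v] [].
have Wmono i j : (i <= j)%N -> subset (Ws j) (Ws i).
  elim: j => [|j IH]; first by rewrite leqn0 => /eqP ->.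
  rewrite leq_eqVlt => /orP[/eqP -> //|/IH H] v Wv; apply: H.
  by case: (WS j) => sub _ _ _; apply: sub.
(* [gs N] is a combination of the earlier [gs i], which all vanish on [Ws N], yet it does not vanish
   at the point [vs N] of [Ws N]. *)
have [N [c gN]] := mpoly_noetherian gs.
have [_ WvN gv _] := WS N; move: gv; rewrite gN raddf_sum big1 ?eqxx //= => i _.
rewrite mevalM; case: (WS i) => _ _ _ ->; rewrite ?mulr0 //.
exact: Wmono (ltn_ord i) _ WvN.
Qed.

Lemma codim_ge_dim_lt c q Z : (q + c = n.+2)%N -> proj_closed Z ->
  codim_ge proj Z c -> dim_lt q Z.
Proof.
move=> qc cZ codZ; apply: dim_lt_irreducible => // W irrW WZ.
have [chain [E irr strict]] := codZ W irrW WZ.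
apply: dim_lt_sub (dim_lt_chain qc irr strict) => v Wv; exact/E.
Qed.

Lemma proj_closed_sing d (A : polyform k n) : (forall i, A i \is d.-homog) ->
  proj_closed (sing_form A).
Proof.
move=> Ah; exists (fun g => exists i, g = A i); split=> [g [i ->]|v]; first by exists d.
by split=> -[pv H]; split=> //; [move=> g [i ->] | move=> i; apply: H; exists i].
Qed.

Lemma codim_ge_sub (U Z Z' : vec k n -> Prop) c :
  subset Z Z' -> codim_ge U Z' c -> codim_ge U Z c.
Proof. by move=> ZZ' H W irr WZ; apply: H => // v /WZ/ZZ'. Qed.

(** * Restriction of codimension bounds to basic open sets *)

Section BasicOpen.

Variables (g : {mpoly k[n.+1]}) (e : nat).
Hypothesis ge : g \is e.-homog.

Definition basic_open v := proj v /\ g.@[v] != 0.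

Lemma basic_open_open : proj_open basic_open.
Proof.
exists (fun v => proj v /\ g.@[v] = 0); first exact: proj_closed_zeros ge.
move=> v; split=> -[pv H]; split=> //; first by case=> _ E; rewrite E eqxx in H.
by apply/eqP => E; apply: H.
Qed.

Definition proj_closure W v := proj v /\
  forall h d, h \is d.-homog -> (forall u, W u -> h.@[u] = 0) -> h.@[v] = 0.

Lemma proj_closure_closed W : proj_closed (proj_closure W).
Proof.
exists (fun h => (exists d, h \is d.-homog) /\ (forall u, W u -> h.@[u] = 0)).
split=> [h [] //|v]; split=> -[pv H]; split=> // h; first by case=> -[d hd]; apply: H hd.
by move=> d hd hW; apply: H; split=> //; exists d.
Qed.

Lemma proj_closure_min W Z : proj_closed Z -> subset W Z -> subset (proj_closure W) Z.
Proof.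
move=> [S [Sh H]] WZ v [pv cv]; apply/H; split=> // h Sh'.
have [d hd] := Sh _ Sh'; apply: (cv _ _ hd) => u /WZ/H[_]; exact.
Qed.

(** Density of a nonempty open part: for each equation [h] of [Z], the product of [h] and [g]
    vanishes on [C]. *)
Lemma irreducible_open_sub C Z : irreducible_closed_in proj C -> proj_closed Z ->
  (exists2 v, C v & g.@[v] != 0) ->
  (forall v, C v -> g.@[v] != 0 -> Z v) -> subset C Z.
Proof.
move=> irrC [S [Sh H]] neC CZ v Cv.
have cC : proj_closed C by case: irrC => /proj_closed_of_in.
apply/H; split=> [|h Sh']; first exact: proj_closed_sub Cv.
apply: (irreducible_nonzerodivisor irrC ge neC) Cv => u Cu.
have [->|gu] := eqVneq g.@[u] 0; first by rewrite mulr0.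
by have /H[_ ->] := CZ u Cu gu; rewrite ?mul0r.
Qed.

Lemma irreducible_basic_open C : irreducible_closed_in proj C ->
  (exists2 v, C v & g.@[v] != 0) ->
  irreducible_closed_in basic_open (fun v => C v /\ g.@[v] != 0).
Proof.
move=> irrC neC; have cC : proj_closed C by case: irrC => /proj_closed_of_in.
split.
- exists C => // v; split=> [[Cv gv]|[[pv gv] Cv]] //; split=> //; split=> //.
  exact: proj_closed_sub Cv.
- by case: neC => v Cv gv; exists v.
move=> Z1 Z2 [Z1' c1 E1] [Z2' c2 E2] sub.
have subZ Z Z' : (forall v, Z v <-> basic_open v /\ Z' v) -> subset C Z' ->
    subset (fun v => C v /\ g.@[v] != 0) Z.
  move=> E s v [Cv gv]; apply/E; split; last exact: s.
  by split=> //; apply: proj_closed_sub Cv.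
apply: NNPP => /not_or_and[n1 n2].
have sep Z' : proj_closed Z' -> ~ subset C Z' ->
    exists h d, [/\ h \is d.-homog, exists2 v, C v & h.@[v] != 0 & forall u, Z' u -> h.@[u] = 0].
  move=> cZ' ns; have [v Cv nv] : exists2 v, C v & ~ Z' v.
    by apply: NNPP => N; apply: ns => v Cv; apply: NNPP => nv; apply: N; exists v.
  have [h [d [hd hv hZ]]] := proj_closed_sep cZ' (proj_closed_sub cC Cv) nv.
  by exists h, d; split=> //; exists v.
have [h1 [d1 [h1d [v1 Cv1 hv1] h1Z]]] := sep _ c1 (fun s => n1 (subZ _ _ E1 s)).
have [h2 [d2 [h2d ne2 h2Z]]] := sep _ c2 (fun s => n2 (subZ _ _ E2 s)).
move/eqP: hv1; apply; move: v1 Cv1.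
apply: (irreducible_nonzerodivisor irrC h2d ne2) => u Cu; rewrite -mevalM; move: u Cu.
apply: (irreducible_nonzerodivisor irrC ge neC) => u Cu.
have [->|gu] := eqVneq g.@[u] 0; first by rewrite mulr0.
have [/E1[_ Zu]|/E2[_ Zu]] := sub u (conj Cu gu).
  by rewrite mevalM h1Z ?mul0r.
by rewrite mevalM h2Z // mulr0 mul0r.
Qed.

(** A chain starting at the projective closure of [W] is cut back to the open set. Its members
    contain [W], hence meet the open set densely, and the inclusions stay strict. *)
Lemma codim_ge_basic_open Z c : proj_closed Z -> codim_ge proj Z c ->
  codim_ge basic_open (fun v => basic_open v /\ Z v) c.
Proof.
move=> cZ codZ W [[W' cW' WE] [w Ww] irrW] WZ.
have Wg v : W v -> g.@[v] != 0 by move=> /WZ[[]].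
have Wcl : subset W (proj_closure W).
  move=> v Wv; split; first by case: (WZ v Wv) => -[].
  by move=> h d _; apply.
have irrcl : irreducible_closed_in proj (proj_closure W).
  split=> [||Z1 Z2 /proj_closed_of_in c1 /proj_closed_of_in c2 sub].
  - exact: closed_in_proj (proj_closure_closed W).
  - by exists w; apply: Wcl.
  have cin Z1' : proj_closed Z1' -> closed_in basic_open (fun v => basic_open v /\ Z1' v).
    by move=> c'; exists Z1'.
  case: (irrW _ _ (cin _ c1) (cin _ c2)) => [v Wv|s|s].
  - by have [? _] := WZ v Wv; case: (sub v (Wcl v Wv)) => ?; [left | right].
  - by left; apply: proj_closure_min => // v /s[].
  - by right; apply: proj_closure_min => // v /s[].
have [|chain [E irr strict]] := codZ _ irrcl.
  by apply: proj_closure_min => // v /WZ[].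
have mono i : (i <= c)%N -> subset (chain 0%N) (chain i).
  elim: i => [|i IH] ic v; first by [].
  by move=> /(IH (ltnW ic)); apply: (proj1 (strict i ic)).
have ne i : (i <= c)%N -> exists2 v, chain i v & g.@[v] != 0.
  move=> ic; exists w; last exact: Wg.
  by apply: (mono i ic); apply/E; apply: Wcl.
exists (fun i v => chain i v /\ g.@[v] != 0); split.
- move=> v; split=> [[/E clv gv]|Wv]; last by split; [apply/E; apply: Wcl | apply: Wg].
  apply/WE; split; first by split=> //; case: clv.
  by apply: proj_closure_min clv => // u /WE[].
- by move=> i ic; apply: irreducible_basic_open; [apply: irr | apply: ne].
move=> i ic; have [s ns] := strict i ic; split=> [v [Cv gv]|s'].
  by split=> //; apply: s.
apply: ns; apply: irreducible_open_sub.
- exact: irr.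
- by case: (irr i (ltnW ic)) => /proj_closed_of_in.
- exact: ne.
- by move=> v Cv gv; case: (s' v (conj Cv gv)).
Qed.

End BasicOpen.

End Topology.

(** * Division by forms with small common zeros *)

Section Division.

Variable k : closedFieldType.

Definition nonzero_pt n (v : 'I_n -> k) := exists i, v i != 0.

Lemma nonzero_shear_pt n c (a : 'I_n -> k) w :
  nonzero_pt a -> nonzero_pt (shear_pt c a w).
Proof.
move=> [i ai]; apply: NNPP => N; move/eqP: ai; apply.
apply: (@shear_pt_eq0 k n c a w) => j; apply/eqP/negPn/negP => vj.
by apply: N; exists j.
Qed.

Lemma shear_extension n c (a : 'I_n -> k) (J : {poly {mpoly k[n]}} -> Prop) Q :
  (forall f g, J f -> J g -> J (f + g)) -> (forall f g : {poly _}, J g -> J (f * g)) ->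
  J Q -> unit_lead Q -> (forall r, J r%:P -> r.@[a] = 0) ->
  exists w, forall f, J f -> (unshear c f).@[shear_pt c a w] = 0.
Proof.
move=> JD JM JQ uQ Ja.
have mK : cancel (@mpolyC n k) (meval a) by move=> x; rewrite mevalC.
have [w wJ] := @ideal_extension k _ (meval a) (@mpolyC n k) mK J JD JM Q JQ uQ Ja.
by exists w => f Jf; rewrite meval_shear_pt unshearK wJ.
Qed.

(* The ideal (Y : P) has no zero besides the origin, so that it meets the ring
   of the other variables in a nonzero element as soon as Y is monic. *)
Lemma dvd_of_locally n (Y P : {mpoly k[n.+2]}) : Y != 0 ->
  (forall v, nonzero_pt v -> exists b c, b.@[v] != 0 /\ b * P = Y * c) ->
  exists q, P = q * Y.
Proof.
move=> Y0 H; have [c uY] := shear_unit_lead Y0.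
pose J f := exists g, f * shear c P = shear c Y * g.
have JY : J (shear c Y) by exists (shear c P).
case: (classic (exists2 r, r != 0 & J r%:P)) => [[r r0 [g rE]]|N].
  have [q qE] := unit_lead_dvd_const uY r0 rE.
  by exists (unshear c q); rewrite -[P](shearK c) qE unshearM shearK.
have [|||w wJ] := @shear_extension _ c (fun _ => 1) J (shear c Y) _ _ JY uY.
- by move=> f g [f' fE] [g' gE]; exists (f' + g'); rewrite mulrDl fE gE mulrDr.
- by move=> f g [g' gE]; exists (f * g'); rewrite -mulrA gE mulrCA.
- by move=> r Jr; have [->|r0] := eqVneq r 0; [rewrite meval0 | case: N; exists r].
have [|b [g [bv bP]]] := H (shear_pt c (fun _ => 1) w).
  by apply: nonzero_shear_pt; exists ord0; rewrite oner_neq0.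
have E := wJ (shear c b); rewrite shearK in E.
move/eqP: bv => bv; case: bv; apply: E; exists (shear c g).
by have := congr1 (shear c) bP; rewrite !shearM.
Qed.

Section Koszul.

Variables (n N : nat) (A : 'I_N -> {mpoly k[n.+2]}) (i0 : 'I_N).

Definition common_zeros v := nonzero_pt v /\ forall i, (A i).@[v] = 0.

Hypothesis dimA : dim_lt n.+1 common_zeros.

Variable c : 'I_n.+1 -> k.
Hypothesis uA : unit_lead (shear c (A i0)).

Definition shear_ideal (f : {poly {mpoly k[n.+1]}}) :=
  exists g : 'I_N -> {poly {mpoly k[n.+1]}}, f = \sum_l g l * shear c (A l).

Lemma shear_idealD f g : shear_ideal f -> shear_ideal g -> shear_ideal (f + g).
Proof.
move=> [f' ->] [g' ->]; exists (fun l => f' l + g' l).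
by rewrite -big_split; apply: eq_bigr => l _; rewrite mulrDl.
Qed.

Lemma shear_idealM (f g : {poly {mpoly k[n.+1]}}) : shear_ideal g -> shear_ideal (f * g).
Proof.
move=> [g' ->]; exists (fun l => f * g' l).
by rewrite mulr_sumr; apply: eq_bigr => l _; rewrite mulrA.
Qed.

Lemma shear_ideal_gen l : shear_ideal (shear c (A l)).
Proof.
exists (fun j => (j == l)%:R); rewrite (bigD1 l) //= eqxx mul1r big1 ?addr0 // => j.
by move=> /negPf ->; rewrite mul0r.
Qed.

Lemma shear_ideal_extension a : (forall r, shear_ideal r%:P -> r.@[a] = 0) ->
  exists w, forall l, (A l).@[shear_pt c a w] = 0.
Proof.
move=> Ja; have [w wJ] := shear_extension c shear_idealD shear_idealM (shear_ideal_gen i0) uA Ja.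
by exists w => l; have := wJ _ (shear_ideal_gen l); rewrite shearK.
Qed.

(** Otherwise every point [a] would extend to a common zero of the [A i], and the retained
    coordinates would be algebraically independent on the common zeros, against [dimA]. *)
Lemma elimination : exists2 r, r != 0 & shear_ideal r%:P.
Proof.
apply: NNPP => Nr.
have [F F0 FZ] := dimA (fun i => unshear c ('X_i)%:P).
(* The factor ['X_ord0] makes [a] nonzero, so that the common zero above it is not the origin. *)
have [a] : exists a, (F * 'X_ord0).@[a] != 0.
  by apply: mpoly_nonroot; rewrite mulf_neq0 // -msize_poly_eq0 msizeX.
rewrite mevalM mevalXU mulf_eq0 negb_or => /andP[Fa a0].
have [|w wA] := @shear_ideal_extension a.
  by move=> r Jr; have [->|r0] := eqVneq r 0; [rewrite meval0 | case: Nr; exists r].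
have := FZ (shear_pt c a w); rewrite (@meval_eq _ _ _ a) => [E|i]; last first.
  by rewrite meval_shear_pt unshearK map_polyC /= hornerC mevalXU.
move: Fa; rewrite E ?eqxx //; split=> //.
by apply: nonzero_shear_pt; exists ord0.
Qed.

End Koszul.

Lemma mpoly_koszul1 n N (A b : 'I_N -> {mpoly k[n.+2]}) :
  (exists i, A i != 0) -> dim_lt n.+1 (common_zeros A) ->
  (forall i j, A i * b j = A j * b i) -> exists h, forall j, b j = h * A j.
Proof.
move=> [i0 A0] dimA Ab; have [c uA] := shear_unit_lead A0.
have [r r0 [g rE]] := elimination dimA uA.
have [|h hE] := @koszul_exact1 _ _ (fun l => shear c (A l)) i0 r g (fun l => shear c (b l)) uA r0 rE.
  by move=> i j; have := congr1 (shear c) (Ab i j); rewrite !shearM.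
by exists (unshear c h) => j; rewrite -[b j](shearK c) hE unshearM shearK.
Qed.

(** Exactness in degree 1 applied to [B] gives B = h A, so that h g = 1. *)
Lemma common_factor_const n N (A B : 'I_N -> {mpoly k[n.+2]}) g :
  (exists i, A i != 0) -> dim_lt n.+1 (common_zeros A) ->
  (forall i, A i = g * B i) -> exists c : k, g = c%:MP.
Proof.
move=> [i0 A0] dimA AE.
have [||h hE] := @mpoly_koszul1 _ _ A B _ dimA; first by exists i0.
  by move=> i j; rewrite !AE; ring.
have gh : h * g = 1.
  have B0 : B i0 != 0 by apply: contraNneq A0; rewrite AE => ->; rewrite mulr0.
  by apply: (mulIf B0); rewrite mul1r [RHS]hE AE mulrA.
exists (g@_0); apply: msize1_polyC.
have g0 : g != 0 by apply: contraNneq (oner_neq0 {mpoly k[n.+2]}) => g0; rewrite -gh g0 mulr0.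
have h0 : h != 0 by apply: contraNneq (oner_neq0 {mpoly k[n.+2]}) => h0; rewrite -gh h0 mul0r.
have := msizeM h0 g0; rewrite gh msize1.
have := msize_poly_eq0 h; rewrite (negPf h0).
by case: (msize h) => // s _; rewrite addSn /= => E; rewrite [X in (_ <= X)%N]E leq_addl.
Qed.

Lemma mpoly_koszul2 n N (A : 'I_N -> {mpoly k[n.+3]}) (B : 'I_N -> 'I_N -> {mpoly k[n.+3]}) :
  (exists i, A i != 0) -> dim_lt n.+2 (common_zeros A) -> dim_lt n.+1 (common_zeros A) ->
  (forall i, B i i = 0) -> (forall i j, B i j = - B j i) ->
  (forall i j l, A i * B j l + A j * B l i + A l * B i j = 0) ->
  exists al, forall i j, B i j = A i * al j - A j * al i.
Proof.
move=> [i0 A0] dimA dimA' Bii Balt AB; have [c uA] := shear_unit_lead A0.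
have [r2 r20 Jr2] := elimination dimA uA.
have [c' ur2] := shear_unit_lead r20.
(* [J'] is the first elimination ideal, in coordinates where [r2] is monic up to a unit. A second
   elimination, relying on [dimA'], yields [rho] free of both variables. *)
pose J' (f : {poly {mpoly k[n.+1]}}) := shear_ideal A c (unshear c' f)%:P.
have [rho rho0 Jrho] : exists2 rho, rho != 0 & J' rho%:P.
  apply: NNPP => Nr.
  have [F F0 FZ] := dimA' (fun i => unshear c (unshear c' ('X_i)%:P)%:P).
  have [a] : exists a, (F * 'X_ord0).@[a] != 0.
    by apply: mpoly_nonroot; rewrite mulf_neq0 // -msize_poly_eq0 msizeX.
  rewrite mevalM mevalXU mulf_eq0 negb_or => /andP[Fa a0].
  have [||||w wJ] := @shear_extension _ c' a J' (shear c' r2) _ _ _ ur2.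
  - move=> f g Jf Jg; rewrite /J' unshearD polyCD.
    exact: shear_idealD Jf Jg.
  - move=> f g Jg; rewrite /J' unshearM polyCM.
    exact: shear_idealM Jg.
  - by rewrite /J' shearK.
  - by move=> r Jr; have [->|r0] := eqVneq r 0; [rewrite meval0 | case: Nr; exists r].
  have [|z zA] := @shear_ideal_extension _ _ A i0 c uA (shear_pt c' a w).
    by move=> r Jr; rewrite -[r](shearK c'); apply: wJ; rewrite /J' shearK.
  have := FZ (shear_pt c (shear_pt c' a w) z); rewrite (@meval_eq _ _ _ a) => [E|i]; last first.
    rewrite meval_shear_pt unshearK map_polyC /= hornerC.
    by rewrite meval_shear_pt unshearK map_polyC /= hornerC mevalXU.
  move: Fa; rewrite E ?eqxx //; split=> //.
  by do 2!apply: nonzero_shear_pt; exists ord0.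
have [g2 r2E] := Jr2; have [g1 r1E] := Jrho.
have r10 : unshear c' rho%:P != 0.
  apply: contraNneq rho0 => E; have := unshearK c' rho%:P.
  by rewrite E shear0 => /eqP; rewrite eq_sym polyC_eq0.
have [|||al alE] := @koszul_exact2 _ _ (fun l => shear c (A l)) i0 _ r2 g1 g2
    (fun i j => shear c (B i j)) uA r10 r1E r2E.
(* Regularity of [r2] modulo [rho]: the leading coefficient of [r2] is a unit in a variable that
   [rho] does not involve. *)
- move=> x y /(congr1 (shear c')); rewrite !shearM unshearK => E.
  have [q qE] := unit_lead_div_const ur2 E.
  by exists (unshear c' q); rewrite -[x](shearK c') qE unshearM.
- by split=> [i|i j]; [rewrite Bii shear0 | rewrite Balt shearN].
- by move=> i j l; have := congr1 (shear c) (AB i j l); rewrite !shearD !shearM shear0.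
exists (fun j => unshear c (al j)) => i j.
have E := congr1 (unshear c) (alE i j); rewrite /wedge shearK in E.
exact: etrans E (unshear_wedge _ _ _ _ _).
Qed.

End Division.

(** * Derivations in positive characteristic *)

Section EulerOperators.

Variables (R : comNzRingType) (n : nat).
Implicit Types (P Q A : {mpoly R[n]}) (i : 'I_n).

Definition euler_op i P := 'X_i * P^`M(i).

Lemma euler_opB i P Q : euler_op i (P - Q) = euler_op i P - euler_op i Q.
Proof. by rewrite /euler_op mderivB mulrBr. Qed.

Lemma mcoeff_euler_op i P m : (euler_op i P)@_m = (m i)%:R * P@_m.
Proof.
rewrite [P]mpolyE /euler_op !raddf_sum mulr_sumr !raddf_sum /= mulr_sumr.
apply: eq_bigr => m' _; rewrite mderivZ mderivX -!scalerAr !mcoeffZ -mpolyXD.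
have [mi|mi] := eqVneq (m' i) 0%N.
  rewrite mi mul0r mulr0 mcoeffX; case: eqP => [<-|]; last by rewrite !mulr0.
  by rewrite mi mul0r.
rewrite addmC submK ?lep1mP // mcoeffX; case: eqP => [->|]; last by rewrite !mulr0.
by ring.
Qed.

Lemma mcoeff_iter_euler_op i e P m :
  (iter e (euler_op i) P)@_m = (m i)%:R ^+ e * P@_m.
Proof.
elim: e => [|e IH]; first by rewrite mul1r.
by rewrite iterS mcoeff_euler_op IH mulrA -exprS.
Qed.

Lemma euler_identity d P : P \is d.-homog -> \sum_i 'X_i * P^`M(i) = d%:R *: P.
Proof.
move=> hP; apply/mpolyP => m; rewrite raddf_sum mcoeffZ /=.
under eq_bigr => i _ do rewrite -/(euler_op i P) mcoeff_euler_op.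
rewrite -mulr_suml -natr_sum -mdegE; case: (eqVneq (P@_m) 0) => [->|]; first by rewrite !mulr0.
by rewrite -mcoeff_msupp => /(dhomogP _ _ _ hP) <-.
Qed.

Lemma mderiv_pihomog d P i : (pihomog mdeg d.+1 P)^`M(i) = pihomog mdeg d P^`M(i).
Proof.
apply/mpolyP => m; rewrite mcoeff_deriv !mcoeff_pihomog mdegD mdeg1 addn1 eqSS.
by rewrite mcoeff_deriv; case: eqP => // _; rewrite mul0rn.
Qed.

Lemma mderiv_homog0 P i : P \is 0.-homog -> P^`M(i) = 0.
Proof.
move=> hP; apply/mpolyP => m; rewrite mcoeff_deriv (dhomog_nemf_coeff hP) ?mcoeff0 ?mul0rn //.
by rewrite /= mdegD mdeg1 addn1.
Qed.

Lemma dhomog_mderiv d P i : P \is d.-homog -> P^`M(i) \is d.-1.-homog.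
Proof.
case: d => [|d] hP; last by rewrite -(pihomog_dE hP) mderiv_pihomog pihomogP.
by rewrite mderiv_homog0 ?dhomog0.
Qed.

Lemma pihomog_mul_low D e A Q : A \is D.-homog -> (e < D)%N -> pihomog mdeg e (A * Q) = 0.
Proof.
move=> hA lt; apply/mpolyP => m; rewrite mcoeff_pihomog mcoeff0; case: eqP => // em.
apply: memN_msupp_eq0; apply/negP => /msuppM_le/allpairsP[[m1 m2] /= [m1A _ E]].
by move: lt; rewrite -em E mdegD (dhomogP _ _ _ hA _ m1A) ltnNge leq_addr.
Qed.

Lemma msize_mderiv P i : P != 0 -> (msize P^`M(i) < msize P)%N.
Proof.
move=> P0; have := mmeasure_poly_eq0 mdeg P; rewrite (negPf P0).
case s: (msize P) => [|s'] // _; rewrite ltnS msizeE.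
apply/bigmax_leqP_seq => m mP _; have : P@_(m + U_(i)) != 0.
  apply: contraTneq mP => E; rewrite mcoeff_msupp mcoeff_deriv E mul0rn eqxx //.
by rewrite -mcoeff_msupp => /msize_mdeg_lt; rewrite s mdegD mdeg1 addn1.
Qed.

End EulerOperators.

Section PositiveCharacteristic.

Variables (k : closedFieldType) (p n : nat).
Hypothesis pk : p \in [pchar k].
Implicit Types (P G h : {mpoly k[n]}) (A : 'I_n -> {mpoly k[n]}).

Let p_prime : prime p := pcharf_prime pk.

Lemma pth_root (c : k) : exists x, x ^+ p = c.
Proof.
have p0 := prime_gt0 p_prime.
have [|x] := closed_rootP ('X^p - c%:P) _.
  by rewrite size_XnsubC // eqSS -lt0n.
by move=> /rootP; rewrite !hornerE => /eqP; rewrite subr_eq0 => /eqP; exists x.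
Qed.

(** All exponents are divisible by [p], all coefficients have p-th roots, and Frobenius is
    additive. *)
Lemma mderiv0_pth_power P : (forall i, P^`M(i) = 0) -> exists g, P = g ^+ p.
Proof.
move=> dP; have p0 := prime_gt0 p_prime.
have dvd m i : m \in msupp P -> (p %| m i)%N.
  rewrite mcoeff_msupp => Pm; have := congr1 (fun Q => ('X_i * Q)@_m) (dP i).
  rewrite -/(euler_op i P) mcoeff_euler_op mulr0 mcoeff0 => /eqP.
  by rewrite mulf_eq0 (negPf Pm) orbF (dvdn_pcharf pk).
pose rt c := proj1_sig (constructive_indefinite_description _ (pth_root c)).
have rtE c : rt c ^+ p = c by rewrite /rt; case: constructive_indefinite_description.
pose g := \sum_(m <- msupp P) rt P@_m *: 'X_[[multinom (m i %/ p)%N | i < n]].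
have pm : p \in [pchar {mpoly k[n]}].
  by rewrite inE p_prime /= -mpolyC_nat (pcharf0 pk) mpolyC0.
exists g; rewrite -(pFrobenius_autE pm) rmorph_sum [LHS]mpolyE big_seq [RHS]big_seq.
apply: eq_bigr => m mP; rewrite /= pFrobenius_autE exprZn rtE mpolyXn.
congr (_ *: 'X_[_]); apply/mnmP => i; rewrite mulmnE mnmE divnK //.
exact: dvd.
Qed.

(* The Euler operators are diagonal on monomials with eigenvalues in F_p, so
   that [1 - euler_op i ^ (p - 1)] is the projection to the monomials whose
   exponent of ['X_i] is divisible by [p]; they commute with [h]. *)
Lemma exact_of_integrating_factor A h P : h != 0 -> (forall i, h^`M(i) = 0) ->
  (forall i, P^`M(i) = h * A i) -> exists G, forall i, A i = G^`M(i).
Proof.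
move=> h0 dh dP; have p1 := prime_gt1 p_prime.
have Eh i Q : euler_op i (h * Q) = h * euler_op i Q.
  by rewrite /euler_op mderivM dh; ring.
have iterEh i e Q : iter e (euler_op i) (h * Q) = h * iter e (euler_op i) Q.
  by elim: e => // e IH; rewrite !iterS IH Eh.
suff [P0 [G [PE EP0]]] : exists P0 G, P = P0 + h * G /\
    forall i, i \in enum 'I_n -> euler_op i P0 = 0.
  exists G => i; apply: (mulfI h0); rewrite -dP PE mderivD mderivM dh mul0r add0r.
  suff -> : P0^`M(i) = 0 by rewrite add0r.
  have /eqP := EP0 i (mem_enum _ i); rewrite mulf_eq0 -msize_poly_eq0 msizeX /=.
  by move/eqP.
elim: (enum 'I_n) => [|i l [P0 [G [PE EP0]]]].
  by exists P, 0; rewrite mulr0 addr0.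
have Ecomm j e Q : euler_op j (iter e (euler_op i) Q) = iter e (euler_op i) (euler_op j Q).
  by apply/mpolyP => m; rewrite mcoeff_euler_op !mcoeff_iter_euler_op mcoeff_euler_op; ring.
pose x := 'X_i * A i - euler_op i G.
have E0 : euler_op i P0 = h * x.
  rewrite /x mulrBr -Eh (_ : h * ('X_i * A i) = euler_op i P); last by rewrite /euler_op dP; ring.
  by rewrite -euler_opB PE addrK.
(* By [E0], the part removed from [P0] is a multiple of [h], so it can be moved into [G]. *)
exists (P0 - iter p.-1 (euler_op i) P0), (G + iter p.-2 (euler_op i) x); split.
  have -> : p.-1 = p.-2.+1 by case: (p) p1 => [|[]].
  by rewrite iterSr E0 iterEh PE; ring.
move=> j; rewrite inE => /orP[/eqP ->|jl].
  (* The operator equals its p-th power: its eigenvalues are integers in [k], fixed by Frobenius. *)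
  rewrite euler_opB; apply/eqP; rewrite subr_eq0; apply/eqP/mpolyP => m.
  rewrite !mcoeff_euler_op mcoeff_iter_euler_op mulrA -exprS prednK ?prime_gt0 //.
  by rewrite -(pFrobenius_autE pk) pFrobenius_aut_nat.
rewrite euler_opB Ecomm (EP0 j jl) sub0r.
suff -> : iter p.-1 (euler_op i) 0 = 0 :> {mpoly k[n]} by rewrite oppr0.
by apply/mpolyP => m; rewrite mcoeff_iter_euler_op mcoeff0 mulr0.
Qed.

(** Exactness gives dP = h A. As A is closed, differentiating once more shows that dh is
    proportional to A, so [h], of smaller size, replaces [P] unless dh = 0. *)
Lemma integrating_factor A P : (exists i, A i != 0) ->
  (forall i j, (A j)^`M(i) = (A i)^`M(j)) ->
  (forall b : 'I_n -> {mpoly k[n]}, (forall i j, A i * b j = A j * b i) ->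
     exists h, forall j, b j = h * A j) ->
  (forall i j, A i * P^`M(j) = A j * P^`M(i)) -> (exists i, P^`M(i) != 0) ->
  exists P' h, [/\ h != 0, forall i, h^`M(i) = 0 & forall i, P'^`M(i) = h * A i].
Proof.
move=> [i0 A0] clA exA; move: {2}(msize P) (leqnn (msize P)) => s.
elim: s P => [|s IH] P sP AP [i1 P1].
  by move: sP; rewrite leqn0 msize_poly_eq0 => /eqP P0; rewrite P0 mderiv0 eqxx in P1.
have [h hE] := exA _ AP.
have h0 : h != 0 by apply: contraNneq P1 => h0; rewrite hE h0 mul0r.
case: (classic (exists i, h^`M(i) != 0)) => [dh|N]; last first.
  exists P, h; split=> // i; apply/eqP/negPn/negP => hi; by apply: N; exists i.
apply: (IH h) dh => [|i j].
  have P0 : P != 0 by apply: contraNneq P1 => ->; rewrite mderiv0.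
  rewrite -ltnS; apply: leq_trans sP; apply: leq_ltn_trans (msize_mderiv i0 P0).
  rewrite hE msizeM //; have := msize_poly_eq0 (A i0); rewrite (negPf A0).
  by case: (msize (A i0)) => // t _; rewrite addnS leq_addr.
have := mderiv_comm i j P; rewrite !hE !mderivM clA => /addIr E.
by rewrite [LHS]mulrC E mulrC.
Qed.

End PositiveCharacteristic.

(** * Invariant hypersurfaces in charts *)

Section FieldIdentities.

Variable K : fieldType.

Lemma wedge_dlog_quotient (x X Y Ai Aj Yi Yj Xi Xj : K) : x != 0 -> X != 0 -> Y != 0 ->
  (Ai / x * ((Yj * X - Y * Xj) / X ^+ 2) - Aj / x * ((Yi * X - Y * Xi) / X ^+ 2)) / (Y / X) =
  ((Ai * Yj - Aj * Yi) * X - Y * (Ai * Xj - Aj * Xi)) / (x * X * Y).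
Proof. by move=> x0 X0 Y0; field; rewrite x0 X0 Y0. Qed.

(** With f = a G / b and dG = A, the contribution of dG drops out because w is proportional to A;
    then [G] cancels from the denominator. *)
Lemma wedge_dlog_unit (wi wj G a b Ai Aj Ti Tj : K) : a != 0 -> b != 0 -> G != 0 ->
  wi * Aj = wj * Ai ->
  (wi * ((Tj * G + a * Aj * b) / b ^+ 2) - wj * ((Ti * G + a * Ai * b) / b ^+ 2)) /
    (a * G / b) = (wi * Tj - wj * Ti) / (a * b).
Proof.
move=> a0 b0 G0 E.
have -> : wi * ((Tj * G + a * Aj * b) / b ^+ 2) - wj * ((Ti * G + a * Ai * b) / b ^+ 2) =
    (G * (wi * Tj - wj * Ti) + a * b * (wi * Aj - wj * Ai)) / b ^+ 2 by field.
by rewrite E subrr mulr0 addr0; field; rewrite a0 b0 G0.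
Qed.

Lemma wedge_quotients (c1 q1 c2 q2 Ti Tj a b : K) :
  a != 0 -> b != 0 -> q1 != 0 -> q2 != 0 ->
  (c1 / q1 * Tj - c2 / q2 * Ti) / (a * b) =
  (c1 * (Tj * q2) - c2 * (Ti * q1)) / (q1 * q2 * (a * b)).
Proof. by move=> a0 b0 q10 q20; field; rewrite a0 b0 q10 q20. Qed.

End FieldIdentities.

Section Fractions.

Variables (k : closedFieldType) (n : nat).
Implicit Types (a b c Y G : {mpoly k[n.+1]}) (v : vec k n) (U : vec k n -> Prop).
Local Notation fr := (@frac_of k n).

Lemma frac_ofM a b : fr (a * b) = fr a * fr b. Proof. exact: rmorphM. Qed.
Lemma frac_ofD a b : fr (a + b) = fr a + fr b. Proof. exact: rmorphD. Qed.
Lemma frac_ofB a b : fr (a - b) = fr a - fr b. Proof. exact: rmorphB. Qed.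
Lemma frac_of0 : fr 0 = 0. Proof. exact: rmorph0. Qed.
Lemma frac_of1 : fr 1 = 1. Proof. exact: rmorph1. Qed.
Lemma frac_of_sum (I : Type) (r : seq I) (F : I -> {mpoly k[n.+1]}) :
  fr (\sum_(i <- r) F i) = \sum_(i <- r) fr (F i).
Proof. exact: rmorph_sum. Qed.

Lemma frac_of_eq0 a : (fr a == 0) = (a == 0).
Proof. by rewrite /frac_of tofrac_eq0. Qed.

Lemma frac_of_inj a b : fr a = fr b -> a = b.
Proof. by move=> E; apply/eqP; rewrite -tofrac_eq; apply/eqP. Qed.

Lemma eq_frac a b c d : b != 0 -> d != 0 ->
  fr a / fr b = fr c / fr d -> a * d = c * b.
Proof.
move=> b0 d0 E; apply: frac_of_inj; rewrite !frac_ofM.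
by apply/eqP; rewrite -eqr_div ?frac_of_eq0 // E.
Qed.

Lemma meval_neq0 a v : a.@[v] != 0 -> a != 0.
Proof. by apply: contraNneq => ->; rewrite meval0. Qed.

Lemma mpolyX_neq0 (l : 'I_n.+1) : 'X_l != 0 :> {mpoly k[n.+1]}.
Proof. by rewrite -msize_poly_eq0 msizeX. Qed.

Lemma dhomogX1 (l : 'I_n.+1) : ('X_l : {mpoly k[n.+1]}) \is 1.-homog.
Proof. by rewrite dhomogX /= mdeg1. Qed.

Lemma dhomogXn (l : 'I_n.+1) e : ('X_l ^+ e : {mpoly k[n.+1]}) \is e.-homog.
Proof. by rewrite -[e in e.-homog]mul1n; apply: dhomogMn; apply: dhomogX1. Qed.

Lemma deg_subE (s t e : nat) : s%:Z = t%:Z + - e%:Z <-> t = (s + e)%N.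
Proof. by split; lia. Qed.

Lemma chart_wedge_dlog (A : polyform k n) x X Y i j : x != 0 -> X != 0 -> Y != 0 ->
  wedge_dlog (fun i => fr (A i) / fr x) (fr Y / fr X) i j =
  fr ((A i * Y^`M(j) - A j * Y^`M(i)) * X - Y * (A i * X^`M(j) - A j * X^`M(i))) /
    fr (x * X * Y).
Proof.
move=> x0 X0 Y0; rewrite /wedge_dlog !fderivE // !(frac_ofB, frac_ofM).
by apply: wedge_dlog_quotient; rewrite frac_of_eq0.
Qed.

Section LocalEquations.

Variables (d : nat) (F : foliation k n d) (l : 'I_n.+1).
Let A := fol_form F.
Let U := basic_open ('X_l : {mpoly k[n.+1]}).

Lemma chart_local_equation e Y :
  local_equation e Y U (fr Y / fr ('X_l ^+ e)).
Proof.
have X0 : fr ('X_l ^+ e) != 0 by rewrite frac_of_eq0 expf_neq0 ?mpolyX_neq0.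
exists (fr ('X_l ^+ e))^-1; split; last by rewrite mulrC.
- by rewrite invr_eq0.
- move=> v [_ Xv]; exists 0%N, e, 1, ('X_l ^+ e); split.
  + exact: dhomog1.
  + exact: dhomogXn.
  + by rewrite subrr.
  + by rewrite rmorphXn /= expf_neq0.
  + by rewrite frac_of1 mul1r.
move=> v [_ Xv]; exists e, 0%N, ('X_l ^+ e), 1; split.
- exact: dhomogXn.
- exact: dhomog1.
- by rewrite add0r.
- by rewrite meval1 oner_neq0.
- by rewrite frac_of1 invrK divr1.
Qed.

Lemma chart_local_defining_form :
  local_defining_form F U (fun i => fr (A i) / fr ('X_l ^+ d.+2)).
Proof.
have X0 : fr ('X_l ^+ d.+2) != 0 by rewrite frac_of_eq0 expf_neq0 ?mpolyX_neq0.
have [hA rA] := fol_proj F; split.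
- split=> [i v [_ Xv]|].
    exists d.+1, d.+2, (A i), ('X_l ^+ d.+2); split=> //.
    + exact: dhomogXn.
    + by rewrite rmorphXn /= expf_neq0.
  under eq_bigr => i _ do rewrite mulrA -frac_ofM.
  by rewrite -mulr_suml -frac_of_sum rA frac_of0 mul0r.
- exists (fr ('X_l ^+ d.+2))^-1; first by rewrite invr_eq0.
  by move=> i; rewrite mulrC.
apply: (codim_ge_sub _ (codim_ge_basic_open (dhomogX1 l) (proj_closed_sing hA) (@fol_codim _ _ _ F))).
move=> v [Uv Av]; split=> //; split; first by case: Uv.
move=> i; have [a [b [bv av E]]] := Av i.
have := eq_frac _ (meval_neq0 bv) E; rewrite expf_neq0 ?mpolyX_neq0 // => /(_ isT).
move/(congr1 (meval v)); rewrite !mevalM av mul0r => /eqP.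
by rewrite mulf_eq0 (negPf bv) orbF => /eqP.
Qed.

(** In the chart where ['X_l] does not vanish, clearing denominators turns regularity into local
    divisibility of A /\ dY by [Y]; the term with the derivatives of ['X_l ^+ e] is itself a
    multiple of [Y]. *)
Lemma invariant_chart e Y i j v : Y != 0 -> invariant_hypersurface F e Y -> U v ->
  exists b c, b.@[v] != 0 /\
    b * (A i * Y^`M(j) - A j * Y^`M(i)) = Y * c.
Proof.
move=> Y0 inv Uv.
have X0 m : ('X_l ^+ m : {mpoly k[n.+1]}) != 0 by rewrite expf_neq0 ?mpolyX_neq0.
have [reg _ _ _] := inv U _ _ (basic_open_open (dhomogX1 l)) (ex_intro _ v Uv)
  (chart_local_equation e Y) chart_local_defining_form.
have [s [t [c [b [_ _ _ bv]]]]] := reg i j v Uv.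
rewrite chart_wedge_dlog // => E.
have {}E := eq_frac (mulf_neq0 (mulf_neq0 (X0 _) (X0 _)) Y0) (meval_neq0 bv) E.
set X := 'X_l ^+ e in E *; set M := A i * X^`M(j) - A j * X^`M(i) in E *.
exists (X * b), (c * 'X_l ^+ d.+2 * X + b * M); split.
  by rewrite mevalM mulf_neq0 // rmorphXn /= expf_neq0 //; case: Uv.
rewrite (_ : X * b * _ = ((A i * Y^`M(j) - A j * Y^`M(i)) * X - Y * M) * b + Y * M * b); last by ring.
by rewrite E; ring.
Qed.

End LocalEquations.

Section ExactInvariant.

Variables (d : nat) (F : foliation k n d) (G : {mpoly k[n.+1]}).
Let A := fol_form F.
Hypothesis hG : G \is d.+2.-homog.
Hypothesis dG : forall i, A i = G^`M(i).
Hypothesis G0 : G != 0.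

(** The positive degree of [b] absorbs the drop caused by the derivative, so that no truncated
    predecessor appears when [a] is constant. *)
Lemma dhomog_mderivM s r a b i : a \is s.-homog -> b \is r.+1.-homog ->
  a^`M(i) * b \is (s + r).-homog.
Proof.
case: s => [|s] ha hb; last by rewrite addSnnS; apply: dhomogM (dhomog_mderiv i ha) hb.
by rewrite mderiv_homog0 // mul0r dhomog0.
Qed.

Lemma exact_invariant : invariant_hypersurface F d.+2 G.
Proof.
move=> U f w oU [v0 Uv0] [u [u0 ru rui fE]] [[rw radw] [h h0 wE] _].
have fv v : U v -> exists s t a b,
    [/\ a \is s.-homog, b \is t.-homog, t = (s + d.+2)%N, a.@[v] != 0 & b.@[v] != 0] /\
    f = fr (a * G) / fr b.
  move=> Uv; have [s [t [a [b [ha hb st bv uE]]]]] := ru v Uv.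
  have [s' [t' [a' [b' [_ _ _ b'v u'E]]]]] := rui v Uv.
  exists s, t, a, b; split; last by rewrite fE uE frac_ofM mulrAC.
  split=> //; first exact/deg_subE.
  (* The product of [u] and its inverse gives a a' = b b', so that [a] does not vanish at [v]. *)
  have /eq_frac E : fr (a * a') / fr (b * b') = fr 1 / fr 1.
    by rewrite frac_of1 divr1 !frac_ofM -[RHS](mulfV u0) u'E uE mulf_div.
  have /(congr1 (meval v)) := E (mulf_neq0 (meval_neq0 bv) (meval_neq0 b'v)) (oner_neq0 _).
  rewrite !mevalM meval1 mulr1 mul1r => E'.
  by apply: contraNneq (mulf_neq0 bv b'v) => av; rewrite -E' av mul0r.
have wA i j : w i * fr (A j) = w j * fr (A i) by rewrite !wE; ring.
split.
- move=> i j v Uv; have [s [t [a [b [[ha hb ts av bv] fE']]]]] := fv v Uv.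
  have [a0 b0] := (meval_neq0 av, meval_neq0 bv).
  have [s1 [t1 [c1 [q1 [hc1 hq1 st1 q1v w1E]]]]] := rw i v Uv.
  have [s2 [t2 [c2 [q2 [hc2 hq2 st2 q2v w2E]]]]] := rw j v Uv.
  have [q10 q20] := (meval_neq0 q1v, meval_neq0 q2v).
  have [T fdE hT] : exists2 T : 'I_n.+1 -> {mpoly k[n.+1]},
      forall m, fderiv m f = (fr (T m) * fr G + fr a * fr (A m) * fr b) / fr b ^+ 2
      & forall m c r, c \is r.+1.-homog -> T m * c \is (s + t + r).-homog.
    exists (fun m => a^`M(m) * b - a * b^`M(m)) => [m|m c r hc].
      rewrite fE' fderivE // -!frac_ofM -frac_ofD; congr (fr _ / _).
      by rewrite mderivM dG; ring.
    rewrite (_ : _ * c = a^`M(m) * (b * c) - a * (b^`M(m) * c)); last by ring.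
    rewrite -addnA rpredB //; last by apply: dhomogM => //; apply: dhomog_mderivM.
    by apply: dhomog_mderivM => //; rewrite -addnS; apply: dhomogM.
  have t1S : t1 = s1.+1 by rewrite -addn1; apply/deg_subE.
  have t2S : t2 = s2.+1 by rewrite -addn1; apply/deg_subE.
  exists (s1 + (s + t + s2))%N, (t1 + t2 + (s + t))%N, (c1 * (T j * q2) - c2 * (T i * q1)), (q1 * q2 * (a * b)).
  split.
  + rewrite rpredB //; first by apply: dhomogM; rewrite ?hT // -t2S.
    by rewrite (_ : (s1 + _)%N = s2 + (s + t + s1))%N; [apply: dhomogM; rewrite ?hT // -t1S | ring].
  + by do !apply: dhomogM.
  + by apply/(deg_subE _ _ 2); rewrite t1S t2S; ring.
  + by rewrite !mevalM !mulf_neq0.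
  rewrite /wedge_dlog !fdE [X in _ / X]fE' frac_ofM wedge_dlog_unit ?frac_of_eq0 //.
  by rewrite w1E w2E wedge_quotients ?frac_of_eq0 // frac_ofB !frac_ofM.
- by move=> i; rewrite /wedge_dlog subrr mul0r.
- by move=> i j; rewrite /wedge_dlog -[RHS]mulNr opprB.
move=> j; have [s [t [a [b [[ha hb ts av bv] fE']]]]] := fv v0 Uv0.
(* [f] has degree zero, so this is Euler's identity. *)
have radf : \sum_(i < n.+1) fr 'X_i * fderiv i f = 0.
  have E i : fr 'X_i * fderiv i f =
      fr ('X_i * (a * G)^`M(i) * b - (a * G) * ('X_i * b^`M(i))) / fr b ^+ 2.
    by rewrite fE' fderivE ?(meval_neq0 bv) // mulrA -frac_ofM; congr (fr _ / _); ring.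
  under eq_bigr => i _ do rewrite E.
  rewrite -mulr_suml -frac_of_sum sumrB -mulr_suml -mulr_sumr.
  rewrite (euler_identity (dhomogM ha hG)) (euler_identity hb) -ts.
  by rewrite -scalerAl -scalerAr subrr frac_of0 mul0r.
rewrite /wedge_dlog.
have E i : fr 'X_i * ((w i * fderiv j f - w j * fderiv i f) / f) =
    (fr 'X_i * w i) * (fderiv j f / f) - (fr 'X_i * fderiv i f) * (w j / f) by ring.
under eq_bigr => i _ do rewrite E.
by rewrite sumrB -!mulr_suml radw radf !mul0r subrr.
Qed.

End ExactInvariant.

End Fractions.

(** * Foliations with singular set of codimension at least three *)

Section SmallSingularSet.

Variables (k : closedFieldType) (n d : nat) (F : foliation k n.+2 d).
Hypothesis codim3 : codim_ge (@proj_space k n.+2) (Sing F) 3.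
Let A := fol_form F.

Let hA i : A i \is d.+1.-homog.
Proof. by case: (fol_proj F) => H _; apply: H. Qed.

Let A_neq0 : exists i, A i != 0 := fol_neq0 F.

(** [common_zeros A] is the cone over the singular set, of dimension one more than it; codimension 2
    gives the bound here, and codimension 3 the next one. *)
Let dim2 : dim_lt n.+2 (common_zeros A).
Proof.
by apply: (@codim_ge_dim_lt _ _ 2) (@fol_codim _ _ _ F); rewrite ?addn2 //; apply: proj_closed_sing hA.
Qed.

Let dim3 : dim_lt n.+1 (common_zeros A).
Proof. by apply: (@codim_ge_dim_lt _ _ 3) codim3; rewrite ?addn3 //; apply: proj_closed_sing hA. Qed.

Lemma fol_koszul1 (b : 'I_n.+3 -> {mpoly k[n.+3]}) : (forall i j, A i * b j = A j * b i) ->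
  exists h, forall j, b j = h * A j.
Proof. exact: mpoly_koszul1 A_neq0 dim2. Qed.

Lemma fol_koszul2 (B : 'I_n.+3 -> 'I_n.+3 -> {mpoly k[n.+3]}) :
  (forall i, B i i = 0) -> (forall i j, B i j = - B j i) ->
  (forall i j l, A i * B j l + A j * B l i + A l * B i j = 0) ->
  exists al, forall i j, B i j = A i * al j - A j * al i.
Proof. exact: mpoly_koszul2 A_neq0 dim2 dim3. Qed.

Lemma fol_closed : closed_form A.
Proof.
have [|||al alE] := @fol_koszul2 (ext_d A).
- by move=> i; rewrite /ext_d subrr.
- by move=> i j; rewrite /ext_d opprB.
- exact: (fol_integrable F).
move=> i j; have hB : ext_d A i j \is d.-homog.
  by rewrite /ext_d rpredB //; apply: (dhomog_mderiv _ (hA _)).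
rewrite -(pihomog_dE hB) alE pihomogB.
by rewrite !(pihomog_mul_low _ (hA _)) // subrr.
Qed.

(** Differentiating the radial relation along ['X_j] and exchanging indices by closedness gives A_j
    + (d + 1) A_j = 0, by Euler's identity. *)
Lemma fol_degree_eq0 : d.+2%:R = 0 :> k.
Proof.
have [j Aj] := A_neq0; have [_ radA] := fol_proj F.
have dX : \sum_(i < n.+3) ('X_i)^`M(j) * A i = A j.
  rewrite (bigD1 j) //= big1 ?addr0 => [|i ne]; rewrite mderivX mnm1E.
    by rewrite eqxx scale1r -[X in (X - _)%MM]add0m addmK mpolyX0 mul1r.
  by rewrite (negPf ne) scale0r mul0r.
have rad : A j + \sum_(i < n.+3) 'X_i * (A i)^`M(j) = 0.
  have := congr1 (mderiv j) radA; rewrite mderiv0 raddf_sum /=.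
  by under eq_bigr => i _ do rewrite mderivM; rewrite big_split /= dX.
have E : d.+2%:R *: A j = 0.
  rewrite -[d.+2]addn1 natrD scalerDl scale1r -(euler_identity (hA j)) addrC -[RHS]rad.
  congr (_ + _); apply: eq_bigr => i _; congr (_ * _).
  by apply/eqP; rewrite -subr_eq0; apply/eqP/fol_closed.
by apply/eqP; move/eqP: E; rewrite mscalerI (negPf Aj) orbF.
Qed.

Lemma invariant_wedge0 e Y : reduced_hypersurface e Y -> invariant_hypersurface F e Y ->
  forall i j, A i * Y^`M(j) = A j * Y^`M(i).
Proof.
move=> [e0 Y0 hY _] inv.
have dvd i j : exists q, A i * Y^`M(j) - A j * Y^`M(i) = q * Y.
  apply: dvd_of_locally (Y0) _ => v [l vl].
  apply: (@invariant_chart _ _ _ F l e) => //; split; first by exists l.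
  by rewrite mevalXU.
pose Th i j := proj1_sig (constructive_indefinite_description _ (dvd i j)).
have ThE i j : A i * Y^`M(j) - A j * Y^`M(i) = Th i j * Y.
  by rewrite /Th; case: constructive_indefinite_description.
have [|||al alE] := @fol_koszul2 Th.
- by move=> i; apply: (mulIf Y0); rewrite -ThE mul0r subrr.
- by move=> i j; apply: (mulIf Y0); rewrite mulNr -!ThE opprB.
- move=> i j l; apply: (mulIf Y0).
  by rewrite !mulrDl mul0r -!mulrA -!ThE; ring.
move=> i j; apply/eqP; rewrite -subr_eq0; apply/eqP.
(* This degree is one less than that of [A l * Y], so multiples of the latter have no component in
   it. *)
have hN : A i * Y^`M(j) - A j * Y^`M(i) \is (d.+1 + e.-1).-homog.
  by rewrite rpredB //; apply: dhomogM (hA _) (dhomog_mderiv _ hY).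
rewrite -(pihomog_dE hN) ThE alE mulrBl pihomogB.
have low l q : pihomog mdeg (d.+1 + e.-1) (A l * q * Y) = 0.
  rewrite mulrAC; apply: pihomog_mul_low (dhomogM (hA l) hY) _.
  by rewrite ltn_add2l prednK.
by rewrite !low subrr.
Qed.

Lemma exact_of_invariant p : p \in [pchar k] ->
  has_reduced_invariant_hypersurface F -> exact_form d A.
Proof.
move=> pk [e [Y [redY inv]]]; have [e0 Y0 hY sqfree] := redY.
have dY : exists i, Y^`M(i) != 0.
  (* Otherwise [Y] is the p-th power of some [g], constant because [Y] is reduced, and [Y] has
     degree 0. *)
  apply: NNPP => N; have [i|g gE] := mderiv0_pth_power pk (P := Y).
    by apply/eqP/negPn/negP => Yi; apply: N; exists i.
  have [c cE] : exists c : k, g = c%:MP.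
    apply: (sqfree g (g ^+ (p - 2))); rewrite gE -exprD subnKC //.
    exact: prime_gt1 (pcharf_prime pk).
  have Y0h : Y \is 0.-homog.
    by rewrite gE cE -rmorphXn /= -[_%:MP]alg_mpolyC; apply: dhomogZ; apply: dhomog1.
  by rewrite (dhomog_uniq Y0 hY Y0h) in e0.
have clA i j : (A j)^`M(i) = (A i)^`M(j).
  by apply/eqP; rewrite -subr_eq0; apply/eqP/fol_closed.
have [P [h [h0 dh dP]]] :=
  integrating_factor A_neq0 clA fol_koszul1 (invariant_wedge0 redY inv) dY.
have [G GE] := exact_of_integrating_factor pk h0 dh dP.
(* [G] need not be homogeneous; its component of degree d + 2 has the same differential, since the
   form is homogeneous. *)
exists (pihomog mdeg d.+2 G); first exact: pihomogP.
by move=> i; rewrite mderiv_pihomog -GE (pihomog_dE (hA i)).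
Qed.

Lemma invariant_of_exact : exact_form d A -> has_reduced_invariant_hypersurface F.
Proof.
move=> [G hG dG]; exists d.+2, G.
have G0 : G != 0.
  by have [i Ai] := A_neq0; apply: contraNneq Ai => G0; rewrite dG G0 mderiv0.
split; last exact: exact_invariant.
split=> // g h GE.
(* A square factor of [G] makes [g] divide every coefficient of dG = g (2 h dg + g dh). *)
apply: (common_factor_const A_neq0 dim2 (B := fun i => g^`M(i) * h *+ 2 + g * h^`M(i))) => i.
by rewrite dG GE expr2 !mderivM; ring.
Qed.

End SmallSingularSet.

Theorem theorem1p6 (k : closedFieldType) (p n d : nat) (F : foliation k n d) :
  has_characteristic k p ->
  (2 <= n)%N ->
  codim_ge (@proj_space k n) (Sing F) 3 ->
  [/\ (0 < p)%N,
      (p %| d.+2)%N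
    & exists Omega : polyform k n,
        [/\ projective_form d Omega, defines F Omega, closed_form Omega
          & has_reduced_invariant_hypersurface F <-> exact_form d Omega]].
Proof.
case: n F => [|[|n]] // F chark _ codim3; have deg0 := fol_degree_eq0 codim3.
have pk : p \in [pchar k].
  (* Characteristic zero is impossible, because d + 2 vanishes in [k]. *)
  move: chark; rewrite /has_characteristic; case: eqP => // _ pk0.
  have [q] := natf0_pchar (ltn0Sn _) (introT eqP deg0).
  by rewrite pk0.
split; first exact: prime_gt0 (pcharf_prime pk).
  by rewrite (dvdn_pcharf pk) deg0.
exists (fol_form F); split.
- exact: fol_proj.
- by exists 1; [apply: oner_neq0 | move=> i; rewrite scale1r].
- exact: fol_closed.
by split; [apply: exact_of_invariant pk | apply: invariant_of_exact].
Qed.
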